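(* Let $P$ be a positroid that decomposes under direct sums and $2$-sums into a collection of positroids all of which have rank at most $2$ or corank at most $2$. Then $\Omega_P$ is a join-semilattice.
   Context: An ordered matroid is a (finite) matroid whose ground set is totally ordered. A positroid is an ordered matroid on $\{i_1<\dots<i_n\}$, of rank $r$, that can be realized by a full-rank real $r\times n$ matrix (columns indexed in order) all of whose maximal minors are nonnegative. On $E=\{i_1<\dots<i_n\}$ let $\leq_{i_k}$ be the order $i_k<i_{k+1}<\dots<i_n<i_1<\dots<i_{k-1}$. The Grassmann necklace of an ordered matroid $M$ on $E$ is $\mathcal{J}(M)=(J_1,\dots,J_n)$, with $J_j$ the lexicographically minimal basis of $M$ with respect to $\leq_{i_j}$. For a positroid $P$, its positroid envelope class $\Omega_P$ is the set of all ordered matroids $M$ on the ordered set $E(P)$ with $\mathcal{J}(M)=\mathcal{J}(P)$, partially ordered by $N\le M$ iff $\mathcal{B}(N)\subseteq\mathcal{B}(M)$ (the rank-preserving weak map order). $2$-sum: if $M,N$ are matroids with $|E(M)|,|E(N)|\ge 2$, $E(M)\cap E(N)=\{e\}$, and $e$ is neither a loop nor a coloop of $M$ or of $N$, then $M\oplus_2 N$ is the matroid on $(E(M)\cup E(N))\setminus\{e\}$ whose circuits are $\mathcal{C}(M\setminus e)\cup\mathcal{C}(N\setminus e)\cup\{(C_1\cup C_2)\setminus\{e\}: e\in C_1\in\mathcal{C}(M),\, e\in C_2\in\mathcal{C}(N)\}$. ''Decomposes under direct sums and $2$-sums into a collection'' means $P$ is obtained from the members of the collection by a sequence of direct sums and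 $2$-sums. The corank of a matroid is the rank of its dual. *)

(* Defs.v *)
From HB Require Import structures.
From mathcomp Require Import all_boot all_order all_algebra.
From mathcomp Require Import reals.

Set Implicit Arguments.
Unset Strict Implicit.
Unset Printing Implicit Defensive.

(* The labels are drawn from a finite type T, and the ground set of a matroid
   is an arbitrary subset of T.  The labels outside the ground set of a matroid
   are available as basepoints for 2-sums; since any finite family of finite
   matroids lives in some T, quantifying over all T loses no generality.

   The fields of both records are boolean, so that equality of matroids is
   equality of ground sets and of sets of bases. *)

Record matroid (T : finType) := Matroid {
  ground : {set T};
  bases : {set {set T}};
  bases_ground : [forall B in bases, B \subset ground];
  bases_neq0 : bases != set0;
  bases_exchange :
    [forall B1 in bases, forall B2 in bases, forall x in B1 :\: B2,
       exists y in B2 :\: B1, y |: B1 :\ x \in bases]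
}.

(* The sequence ground_seq M lists the ground set as i_1 < ... < i_n; this total
   order is not tied to any order on T. *)
Record ordered_matroid (T : finType) := OrderedMatroid {
  mat :> matroid T;
  ground_seq : seq T;
  ground_seq_uniq : uniq ground_seq;
  ground_seq_ground : [set x in ground_seq] == ground mat
}.

Section MatroidTheory.

Variable T : finType.
Implicit Types (M N S : matroid T) (B I C : {set T}) (e : T).

Definition mrank M : nat := \max_(B in bases M) #|B|.

Definition indep M I : bool := [exists B in bases M, I \subset B].

Definition circuits M : {set {set T}} :=
  [set C | minset [pred D : {set T} | (D \subset ground M) && ~~ indep M D] C].

Lemma baseS M B : B \in bases M -> B \subset ground M.
Proof. by move=> BM; apply: (forall_inP (bases_ground M)). Qed.

Lemma base_exchange M B1 B2 x :
  B1 \in bases M -> B2 \in bases M -> x \in B1 -> x \notin B2 ->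
  exists y, [/\ y \in B2, y \notin B1 & y |: B1 :\ x \in bases M].
Proof.
move=> B1M B2M xB1 xB2.
have /forall_inP/(_ _ B1M)/forall_inP/(_ _ B2M)/forall_inP/(_ x) :=
  bases_exchange M.
rewrite inE xB1 xB2 => /(_ isT) /exists_inP[y].
by rewrite inE => /andP[? ?] ?; exists y.
Qed.

Lemma card_swap (B : {set T}) x y :
  x \in B -> y \notin B -> #|y |: B :\ x| = #|B|.
Proof.
move=> xB yB; rewrite cardsU1 !inE (negbTE yB) andbF add1n.
by rewrite (cardsD1 x B) xB add1n.
Qed.

Lemma card_base_le M B1 B2 :
  B1 \in bases M -> B2 \in bases M -> #|B1| <= #|B2|.
Proof.
have [n] := ubnP #|B1 :\: B2|; elim: n B1 => // n IHn B1 lt_n B1M B2M.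
have [/eqP B120|[x]] := set_0Vmem (B1 :\: B2).
  by rewrite setD_eq0 in B120; apply: subset_leq_card.
rewrite inE => /andP[xB2 xB1].
have [y [yB2 yB1 B3M]] := base_exchange B1M B2M xB1 xB2.
rewrite -(card_swap xB1 yB1); apply: IHn B3M B2M.
rewrite -ltnS; apply: leq_trans lt_n; rewrite ltnS.
apply: proper_card; apply/properP; split.
  apply/subsetP=> z; rewrite !inE => /andP[zB2 /orP[/eqP zy|/andP[_ ->]]].
    by rewrite zy yB2 in zB2.
  by rewrite zB2.
exists x; rewrite !inE xB1 xB2 ?eqxx //= orbF.
by apply: contraNneq xB2 => ->.
Qed.

Lemma card_base M B1 B2 :
  B1 \in bases M -> B2 \in bases M -> #|B1| = #|B2|.
Proof. by move=> B1M B2M; apply/eqP; rewrite eqn_leq !(@card_base_le M). Qed.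

Lemma mrankE M B : B \in bases M -> mrank M = #|B|.
Proof.
move=> BM; apply/eqP; rewrite eqn_leq (bigmax_sup B) // andbT.
by apply/bigmax_leqP=> B' B'M; apply: card_base_le B'M BM.
Qed.

Lemma base_coexchange M B1 B2 x :
  B1 \in bases M -> B2 \in bases M -> x \in B2 -> x \notin B1 ->
  exists y, [/\ y \in B1, y \notin B2 & x |: B1 :\ y \in bases M].
Proof.
move=> B1M B2M xB2 xB1.
suff [B3 [B3M /setP B31 sB3]] :
    exists B3, [/\ B3 \in bases M, B3 :\: B1 = [set x] & B1 :&: B2 \subset B3].
  have card_13 : #|B1 :\: B3| = 1%N.
    have := card_base B1M B3M; rewrite -(cardsID B3) -(cardsID B1 B3) setIC.
    move/addnI=> ->; apply/eqP/cards1P; exists x; exact/setP.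
  have /eqP/cards1P[y /setP B13] := card_13.
  have := B13 y; rewrite !inE eqxx => /andP[yB3 yB1].
  exists y; split=> //.
    apply: contra yB3 => yB2; apply: (subsetP sB3).
    by rewrite inE yB1.
  suff -> : x |: B1 :\ y = B3 by [].
  apply/setP=> z; have := B31 z; have := B13 z; rewrite !inE => <- <-.
  by case: (z \in B1); case: (z \in B3).
suff gen m B3 : #|B3 :\: B1| <= m -> B3 \in bases M -> x \in B3 ->
    B1 :&: B2 \subset B3 ->
    exists B4, [/\ B4 \in bases M, B4 :\: B1 = [set x] & B1 :&: B2 \subset B4].
  exact: gen (leqnn _) B2M xB2 (subsetIr _ _).
elim: m B3 => [|m IHm] B3 le_m B3M xB3 sB3.
  move: le_m; rewrite leqn0 cards_eq0 setD_eq0 => /subsetP/(_ _ xB3).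
  by rewrite (negbTE xB1).
have [/eqP B31|[z]] := set_0Vmem (B3 :\: B1 :\ x).
  exists B3; split=> //; apply/setP=> z; rewrite !inE.
  move: B31; rewrite setD_eq0 => /subsetP/(_ z); rewrite !inE.
  have [->|_] := eqVneq z x; first by rewrite xB1 xB3.
  by case: (_ && _) => // /(_ isT).
rewrite !inE => /and3P[zx zB1 zB3].
have [w [wB1 wB3 B4M]] := base_exchange B3M B1M zB3 zB1.
apply: (IHm (w |: B3 :\ z)) => //.
- rewrite -ltnS; apply: leq_trans le_m.
  apply: proper_card; apply/properP; split.
    apply/subsetP=> t; rewrite !inE => /andP[tB1 /orP[/eqP tw|/andP[_ ->]]].
      by rewrite tw wB1 in tB1.
    by rewrite tB1.
  exists z; rewrite !inE zB1 ?zB3 // eqxx /= orbF.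
  by apply: contraNneq zB1 => ->.
- by rewrite !inE xB3 [x == z]eq_sym zx orbT.
- apply/subsetP=> t tB; rewrite !inE (subsetP sB3 _ tB) andbT.
  apply/orP; right; apply: contraTneq tB => ->.
  by rewrite inE (negbTE zB1).
Qed.

Definition cobases M : {set {set T}} := [set ground M :\: B | B in bases M].

Lemma cobases_ground M : [forall B in cobases M, B \subset ground M].
Proof. by apply/forall_inP=> _ /imsetP[B _ ->]; apply: subsetDl. Qed.

Lemma cobases_neq0 M : cobases M != set0.
Proof.
have /set0Pn[B BM] := bases_neq0 M.
by apply/set0Pn; exists (ground M :\: B); apply: imset_f.
Qed.

Lemma cobases_exchange M :
  [forall B1 in cobases M, forall B2 in cobases M, forall x in B1 :\: B2,
     exists y in B2 :\: B1, y |: B1 :\ x \in cobases M].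
Proof.
apply/forall_inP=> _ /imsetP[B1 B1M ->]; apply/forall_inP=> _ /imsetP[B2 B2M ->].
apply/forall_inP=> x; rewrite !inE negb_and negbK.
case/andP=> + /andP[xB1 xE]; rewrite xE orbF => xB2.
have [y [yB1 yB2 B3M]] := base_coexchange B1M B2M xB2 xB1.
have yE := subsetP (baseS B1M) _ yB1.
apply/exists_inP; exists y; first by rewrite !inE yB1 yB2 yE.
apply/imsetP; exists (x |: B1 :\ y) => //; apply/setP=> z; rewrite !inE.
have [->|_] := eqVneq z y; last by have [->|_] := eqVneq z x.
have yx : y != x by apply: contraNneq xB1 => <-.
by rewrite yE (negbTE yx).
Qed.

Definition dual M : matroid T :=
  Matroid (cobases_ground M) (cobases_neq0 M) (cobases_exchange M).

Definition mcorank M : nat := mrank (dual M).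

Definition loop M e : bool := [set e] \in circuits M.

Definition coloop M e : bool := loop (dual M) e.

Definition is_direct_sum M N S : Prop :=
  [/\ [disjoint ground M & ground N],
      ground S = ground M :|: ground N
    & bases S = [set B1 :|: B2 | B1 in bases M, B2 in bases N]].

Definition deletion_circuits M e : {set {set T}} :=
  [set C in circuits M | e \notin C].

Definition two_sum_circuits M N e : {set {set T}} :=
  deletion_circuits M e :|: deletion_circuits N e
  :|: [set (C1 :|: C2) :\ e | C1 in [set C in circuits M | e \in C],
                              C2 in [set C in circuits N | e \in C]].

Definition is_two_sum M N S : Prop :=
  exists e : T,
    [/\ (2 <= #|ground M|) && (2 <= #|ground N|),
        ground M :&: ground N = [set e],
        [&& ~~ loop M e, ~~ coloop M e, ~~ loop N e & ~~ coloop N e],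
        ground S = (ground M :|: ground N) :\ e
      & circuits S = two_sum_circuits M N e].

(* Direct sums and 2-sums are operations on matroids, so the orders of the
   members of the collection are not required to be related to one another. *)
Inductive decomposes_into (Coll : ordered_matroid T -> Prop) :
    matroid T -> Prop :=
| DecMember Q of Coll Q : decomposes_into Coll (mat Q)
| DecDirectSum M N S of decomposes_into Coll M & decomposes_into Coll N
    & is_direct_sum M N S : decomposes_into Coll S
| DecTwoSum M N S of decomposes_into Coll M & decomposes_into Coll N
    & is_two_sum M N S : decomposes_into Coll S.

End MatroidTheory.

Section Positroids.

Variable T : finType.
Implicit Types (M N P : ordered_matroid T) (B : {set T}).

Definition labels M (J : {set 'I_(size (ground_seq M))}) : {set T} :=
  [set tnth (in_tuple (ground_seq M)) j | j in J].

(* The j-th column of A represents the j-th element of the ground set, and the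
   columns with index in J are linearly independent iff they form a submatrix
   of rank #|J|. *)
Definition represents (F : fieldType) M m (A : 'M[F]_(m, size (ground_seq M))) :
    Prop :=
  forall J : {set 'I_(size (ground_seq M))},
    indep M (labels J)
      = (\rank (colsub (@enum_val _ (mem J)) A) == #|J|).

Definition maximal_minors_ge0 (R : realType) m n (A : 'M[R]_(m, n)) : Prop :=
  forall f : 'I_m -> 'I_n,
    {homo f : i j / (i < j)%N} -> (0 <= \det (colsub f A))%R.

Definition positroid (R : realType) M : Prop :=
  exists A : 'M[R]_(mrank M, size (ground_seq M)),
    [/\ row_free A, represents A & maximal_minors_ge0 A].

(* The increasing list of the positions of the elements of B in s. *)
Definition positions (s : seq T) B : seqlexi nat :=
  [seq index x s | x <- s & x \in B].

Definition lexmin_pred M (s : seq T) : pred {set T} := fun B =>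
  (B \in bases M) && [forall B' in bases M, (positions s B <= positions s B')%O].

Definition lexmin_basis M (s : seq T) : {set T} :=
  odflt set0 [pick B | lexmin_pred M s B].

Lemma lexmin_basisP M (s : seq T) : lexmin_pred M s (lexmin_basis M s).
Proof.
rewrite /lexmin_basis; case: pickP => //= noB.
have /set0Pn[B0 B0M] := bases_neq0 M.
case: (@Order.TotalTheory.arg_minP _ _ _ B0 (mem (bases M)) (positions s) B0M).
move=> B BM minB; have /negP[] := negbT (noB B).
by apply/andP; split=> //; apply/forall_inP.
Qed.

Definition necklace M : seq {set T} :=
  [seq lexmin_basis M (rot k (ground_seq M)) | k <- iota 0 (size (ground_seq M))].

Definition envelope_class P : ordered_matroid T -> Prop := fun M =>
  ground_seq M = ground_seq P /\ necklace M = necklace P.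

Definition weak_le : rel (ordered_matroid T) := fun N M =>
  bases N \subset bases M.

End Positroids.

Definition is_partial_order_on (X : Type) (A : X -> Prop) (le : rel X) : Prop :=
  [/\ forall x, A x -> le x x,
      forall x y, A x -> A y -> le x y -> le y x -> x = y
    & forall x y z, A x -> A y -> A z -> le x y -> le y z -> le x z].

Definition is_join_on (X : Type) (A : X -> Prop) (le : rel X) (x y z : X) :
    Prop :=
  [/\ A z, le x z, le y z & forall w, A w -> le x w -> le y w -> le z w].

Definition is_join_semilattice (X : Type) (A : X -> Prop) (le : rel X) : Prop :=
  is_partial_order_on A le /\
  forall x y, A x -> A y -> exists z, is_join_on A le x y z.

(* Main.v *)
Require Import Defs.
From mathcomp Require Import all_boot all_order all_algebra all_fingroup.
From mathcomp Require Import reals.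
From mathcomp Require Import zify ring.

(* Two matroids with the same necklace have the same rank on every cyclic interval.
   Nonnegativity enters only through the 3-term Pluecker relations, which give an
   exchange property for crossing pairs of elements of P.  That property implies,
   first, that M <= P for all M in the envelope class (Oh's theorem), and second,
   that such an M has the same rank as P on every set X whose connectivity
   r(X) + r(E - X) - r(E) in P is at most 1 ([thin_le M P]).

   The relation thin_le no longer refers to the order of the ground set, and it
   decomposes along direct sums and 2-sums.  So joins among the matroids M with
   thin_le M S can be built by induction on the decomposition of S: in rank at
   most 2 such M have the same loops, and the union of two sets of bases is again
   the set of bases of a matroid; corank at most 2 follows by duality.  Finally,
   the join Z of M and N satisfies M <= Z <= P, and this forces its necklace. *)

Set Implicit Arguments.
Unset Strict Implicit.
Unset Printing Implicit Defensive.

(** * Rank *)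

Section Rank.

Variable T : finType.
Implicit Types (M N S : matroid T) (B C D I J X Y : {set T}) (x y z : T).

(** The orders of the summands of a 2-sum are unrelated to the order of [P], so necklaces cannot be
    followed through the decomposition; [thin_le] can. Its bound 1 serves both ends of the
    induction. At a leaf, singletons have connectivity at most 1, so a matroid below [S] has the
    same independent sets of size at most 1 as [S], which is all that exchange in rank 2 uses. At a
    2-sum, replacing the basepoint by the whole of the other summand turns a thin set of one summand
    into a thin set of the 2-sum, so the rank condition passes to the summands.

    At an inner node the join is the sum of the joins of the parts. Its minimality is the delicate
    point: a base of the sum consists of halves of two different bases of a competitor [W]. They can
    be recombined inside [W] because every base of [W] is a base of [S], which fixes how its
    elements are distributed over the two sides, up to one element at a 2-sum. No thinness of the
    join has to be proved: ranks between those of [M] and [S] agree where these two agree. *)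

Definition rk M X : nat := \max_(B in bases M) #|B :&: X|.

Lemma rk_base M B X : B \in bases M -> #|B :&: X| <= rk M X.
Proof. by move=> BM; apply: (bigmax_sup B). Qed.

Lemma rk_attained M X : exists2 B, B \in bases M & #|B :&: X| = rk M X.
Proof.
have /set0Pn[B0 B0M] := bases_neq0 M.
have [|B BM rkE] := @eq_bigmax_cond _ (mem (bases M)) (fun B => #|B :&: X|).
  by apply/card_gt0P; exists B0.
by exists B => //; rewrite /rk rkE.
Qed.

Lemma indepP M I : reflect (exists2 B, B \in bases M & I \subset B) (indep M I).
Proof. exact: exists_inP. Qed.

Lemma base_indep M B : B \in bases M -> indep M B.
Proof. by move=> BM; apply/indepP; exists B. Qed.

Lemma indepS M I J : I \subset J -> indep M J -> indep M I.
Proof.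
by move=> sIJ /indepP[B BM sJB]; apply/indepP; exists B; rewrite ?(subset_trans sIJ).
Qed.

Lemma indep_ground M I : indep M I -> I \subset ground M.
Proof. by case/indepP=> B BM sIB; apply: subset_trans (baseS BM). Qed.

Lemma exchange_base M B1 B2 x :
  B1 \in bases M -> B2 \in bases M -> x \in B1 :\: B2 ->
  exists2 y, y \in B2 :\: B1 & y |: B1 :\ x \in bases M.
Proof.
move=> B1M B2M; rewrite inE => /andP[xB2 xB1].
have [y [yB2 yB1 BM]] := base_exchange B1M B2M xB1 xB2.
by exists y; rewrite ?inE ?yB1.
Qed.

(** Starting from any base through [I], elements outside [I :|: B] are exchanged one at a time for
    elements of [B]; such exchanges never remove an element of [I]. *)
Lemma indep_extend M I B :
  indep M I -> B \in bases M ->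
  exists2 B', B' \in bases M & I \subset B' /\ B' \subset I :|: B.
Proof.
case/indepP=> B1 B1M sIB1 BM.
have [n] := ubnP #|B1 :\: (I :|: B)|; elim: n B1 B1M sIB1 => // n IHn B1 B1M sI lt_n.
have [/eqP|[x]] := set_0Vmem (B1 :\: (I :|: B)).
  by rewrite setD_eq0 => sB1; exists B1.
rewrite !inE negb_or => /andP[/andP[xI xB] xB1].
have [|y] := @exchange_base M B1 B x B1M BM; first by rewrite !inE xB xB1.
rewrite !inE => /andP[yB1 yB] B2M; apply: IHn B2M _ _.
  apply/subsetP=> z zI; rewrite !inE (subsetP sI _ zI) andbT.
  by apply/orP; right; apply: contraNneq xI => <-.
rewrite ltnS in lt_n; apply: leq_trans lt_n; apply: proper_card.
apply/properP; split.
  apply/subsetP=> z; rewrite !inE negb_or -andbA => /and3P[zI zB].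
  by rewrite (negbTE zI) (negbTE zB) => /orP[/eqP zy|/andP[]//]; rewrite zy yB in zB.
exists x; first by rewrite !inE negb_or xI xB.
by rewrite !inE eqxx orbF negb_and negb_or; apply/orP; right; apply: contraNneq xB => ->.
Qed.

(** Extending [I] by a base that attains the rank of [X] adds no more elements outside [X] than that
    base has, hence leaves at least as many inside. *)
Lemma indep_extend_rk M I X :
  indep M I -> I \subset X ->
  exists2 B, B \in bases M & I \subset B /\ #|B :&: X| = rk M X.
Proof.
move=> indI sIX; have [B0 B0M rk0] := rk_attained M X.
have [B BM [sIB sB]] := indep_extend indI B0M; exists B => //; split=> //.
apply/eqP; rewrite eqn_leq rk_base //= -rk0.
have: #|B :\: X| <= #|B0 :\: X|.
  apply/subset_leq_card/subsetP=> z; rewrite !inE => /andP[zX /(subsetP sB)].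
  by rewrite inE zX => /orP[/(subsetP sIX)|//]; rewrite (negbTE zX).
by have := card_base BM B0M; rewrite -(cardsID X B) -(cardsID X B0); lia.
Qed.

Lemma rk_mono M X Y : X \subset Y -> rk M X <= rk M Y.
Proof.
move=> sXY; have [B BM <-] := rk_attained M X.
by apply: leq_trans (rk_base Y BM); apply/subset_leq_card/setIS.
Qed.

Lemma rk_submod M X Y : rk M (X :|: Y) + rk M (X :&: Y) <= rk M X + rk M Y.
Proof.
have [B BM rkI] := rk_attained M (X :&: Y).
have [||B' B'M [sB rkU]] := @indep_extend_rk M (B :&: (X :&: Y)) (X :|: Y).
- by apply: indepS (base_indep BM); apply: subsetIl.
- by apply: subset_trans (subsetIr _ _) _; rewrite subIset // subsetUl.
have leI : #|B :&: (X :&: Y)| <= #|B' :&: (X :&: Y)|.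
  by apply: subset_leq_card; rewrite subsetI sB subsetIr.
have := rk_base X B'M; have := rk_base Y B'M.
have := cardsUI (B' :&: X) (B' :&: Y); rewrite -setIUr -setIIr; lia.
Qed.

Lemma rk_le_card M X : rk M X <= #|X|.
Proof.
by have [B BM <-] := rk_attained M X; apply/subset_leq_card/subsetIr.
Qed.

Lemma rk_le_mrank M X B : B \in bases M -> rk M X <= #|B|.
Proof.
move=> BM; have [B' B'M <-] := rk_attained M X.
by rewrite (card_base BM B'M) subset_leq_card ?subsetIl.
Qed.

Lemma rk_ground M B : B \in bases M -> rk M (ground M) = #|B|.
Proof.
move=> BM; apply/eqP; rewrite eqn_leq rk_le_mrank //=.
by rewrite -{1}(setIidPl (baseS BM)) rk_base.
Qed.

Lemma rk_indep M I : indep M I -> rk M I = #|I|.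
Proof.
case/indepP=> B BM sIB; apply/eqP; rewrite eqn_leq rk_le_card /=.
by rewrite -{1}(setIidPr sIB) rk_base.
Qed.

Lemma indep_rk M I : rk M I = #|I| -> indep M I.
Proof.
have [B BM <-] := rk_attained M I => cardE; apply/indepP; exists B => //.
apply/setIidPr/eqP; rewrite eqEcard subsetIr; lia.
Qed.

Lemma indep_le_rk M I X : indep M I -> I \subset X -> #|I| <= rk M X.
Proof. by move=> indI /(rk_mono M); rewrite rk_indep. Qed.

Lemma indep_baseP M I B : B \in bases M -> indep M I -> #|B| <= #|I| -> I \in bases M.
Proof.
move=> BM /indepP[B' B'M sI]; rewrite (card_base BM B'M) => le_I.
suff -> : I = B' by []. by apply/eqP; rewrite eqEcard sI.
Qed.

(** If the rank grew, a base extending a maximal independent subset of [X] would contain some [t] of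
    [Y] outside [X], and this [t] alone would raise the rank of [X]. *)
Lemma rk_closure M X Y :
  (forall t, t \in Y -> rk M (t |: X) = rk M X) -> rk M (X :|: Y) = rk M X.
Proof.
move=> clY; apply/eqP; rewrite eq_sym eqn_leq rk_mono ?subsetUl //=.
have [B BM rkX] := rk_attained M X.
have [||B' B'M [sB rkU]] := @indep_extend_rk M (B :&: X) (X :|: Y).
- by apply: indepS (base_indep BM); apply: subsetIl.
- by rewrite subIset // subsetUl orbT.
rewrite -rkU -rkX; have [->//|] := eqVneq (B' :&: (X :|: Y)) (B :&: X).
rewrite eq_sym eqEsubset negb_and subsetI sB subIset ?subsetUl ?orbT //=.
case/subsetPn=> t; rewrite !inE => /andP[tB' tXY] tBX.
have tX : t \notin X.
  apply: contra tBX => tX; rewrite tX andbT.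
  have := rk_base X B'M; rewrite -rkX => le_X.
  suff : t \in B :&: X by rewrite inE => /andP[].
  suff -> : B :&: X = B' :&: X by rewrite inE tB'.
  by apply/eqP; rewrite eqEcard le_X subsetI sB subsetIr.
have tY : t \in Y by rewrite (negbTE tX) in tXY.
have := clY t tY; rewrite -rkX => rkt.
have: #|t |: (B :&: X)| <= rk M (t |: X).
  apply: indep_le_rk; last by apply/setUS/subsetIr.
  by apply: indepS (base_indep B'M); rewrite subUset sub1set tB'.
by rewrite rkt cardsU1 !inE (negbTE tBX); lia.
Qed.

Lemma rk_weak M N X : bases M \subset bases N -> rk M X <= rk N X.
Proof.
move=> sMN; have [B BM <-] := rk_attained M X.
by apply: rk_base; apply: (subsetP sMN).
Qed.

Lemma dependentP M X :
  X \subset ground M -> ~~ indep M X -> exists2 C, C \in circuits M & C \subset X.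
Proof.
move=> sX depX.
have [|C minC sC] := @minset_exists _ [pred D : {set T} | (D \subset ground M) && ~~ indep M D] X.
  by rewrite /= sX.
by exists C => //; rewrite inE.
Qed.

Lemma circuit_dep M C : C \in circuits M -> ~~ indep M C.
Proof. by rewrite inE => /minsetP[/andP[]]. Qed.

Lemma circuit_ground M C : C \in circuits M -> C \subset ground M.
Proof. by rewrite inE => /minsetP[/andP[]]. Qed.

Lemma circuit_indepD1 M C c : C \in circuits M -> c \in C -> indep M (C :\ c).
Proof.
rewrite inE => /minsetP[/andP[sC depC] minC] cC; apply: contraT => depCc.
have sCc : C :\ c \subset C by apply: subD1set.
suff eqC : C :\ c = C by have := cC; rewrite -eqC !inE eqxx.
by apply: (minC _ _ sCc); rewrite /= (subset_trans sCc sC).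
Qed.

Lemma dep_circuit M C : 
  C \subset ground M -> ~~ indep M C -> (forall c, c \in C -> indep M (C :\ c)) ->
  C \in circuits M.
Proof.
move=> sC depC minC; rewrite inE; apply/minsetP; split; first by rewrite /= sC.
move=> D /andP[_ depD] sDC; apply/eqP; rewrite eqEsubset sDC /=.
apply/subsetP=> c cC; apply: contraNT depD => cD.
by apply: indepS (minC c cC); rewrite subsetD1 sDC.
Qed.

(** [C] is the fundamental circuit of [c] with respect to [D]. Extending [C :\ s] by [D] gives a
    base inside [c |: D]; it misses [s], since otherwise it would contain [C]. *)
Lemma circuit_swap M C D c s :
  C \in circuits M -> D \in bases M -> c \in C -> C :\ c \subset D -> s \in C ->
  (c |: D) :\ s \in bases M.
Proof.
move=> CM DM cC sCD sC.
have cD : c \notin D.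
  apply: contra (circuit_dep CM) => cD; apply: indepS (base_indep DM).
  by rewrite -(setD1K cC) subUset sub1set cD.
have [K KM [sCK sKD]] := indep_extend (circuit_indepD1 CM sC) DM.
have sK : s \notin K.
  apply: contra (circuit_dep CM) => sK; apply: indepS (base_indep KM).
  by rewrite -(setD1K sC) subUset sub1set sK.
suff -> : (c |: D) :\ s = K by [].
have sKDs : K \subset (c |: D) :\ s.
  rewrite subsetD1 sK andbT; apply: subset_trans sKD _.
  apply/subsetP=> z; rewrite !inE => /orP[/andP[zs zC]|->]; last exact: orbT.
  have [//|zc] := eqVneq z c.
  by rewrite (subsetP sCD) // !inE zc.
apply/eqP; rewrite eq_sym eqEcard sKDs (card_base KM DM).
have := cardsD1 s (c |: D); rewrite cardsU1 cD.
have -> : s \in c |: D.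
  rewrite !inE; have [//|sc] := eqVneq s c.
  by rewrite (subsetP sCD) // !inE sc.
by move=> /addnI <- /=.
Qed.

End Rank.

(** * Joins and connectivity *)

Section Joins.

Variable T : finType.
Implicit Types (M N S W Z : matroid T) (A B C D I J X Y : {set T}) (x y z e : T).

Lemma matroid_exists (E : {set T}) (F : {set {set T}}) :
  (forall B, B \in F -> B \subset E) -> (exists B, B \in F) ->
  (forall B1 B2 x, B1 \in F -> B2 \in F -> x \in B1 :\: B2 ->
     exists2 y, y \in B2 :\: B1 & y |: B1 :\ x \in F) ->
  exists M, ground M = E /\ bases M = F.
Proof.
move=> gF nF xF.
have gF' : [forall B in F, B \subset E] by apply/forall_inP.
have nF' : F != set0 by apply/set0Pn.
have xF' : [forall B1 in F, forall B2 in F, forall x in B1 :\: B2,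
              exists y in B2 :\: B1, y |: B1 :\ x \in F].
  apply/forall_inP=> B1 B1F; apply/forall_inP=> B2 B2F; apply/forall_inP=> x xB.
  by have [y yB yF] := xF _ _ _ B1F B2F xB; apply/exists_inP; exists y.
by exists (Matroid gF' nF' xF').
Qed.

(** The bases with the most elements in [A] are the bases of the direct sum of the restriction to
    [A] and the contraction by [A], so their halves can be recombined. *)
Lemma splice M A B B' :
  B \in bases M -> B' \in bases M -> #|B :&: A| = #|B' :&: A| ->
  (forall B'', B'' \in bases M -> #|B'' :&: A| <= #|B :&: A|) ->
  (B :&: A) :|: (B' :&: ~: A) \in bases M.
Proof.
have [n] := ubnP #|B :&: ~: A :\: B'|; elim: n B => // n IHn B lt_n BM B'M eqA maxA.
have [/eqP|[x]] := set_0Vmem (B :&: ~: A :\: B').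
  rewrite setD_eq0 => sB.
  suff -> : B' :&: ~: A = B :&: ~: A by rewrite -setIUr setUCr setIT.
  apply/esym/eqP; rewrite eqEcard subsetI sB subsetIr /=.
  have := card_base BM B'M; rewrite -(cardsID A B) -(cardsID A B').
  by rewrite !setDE; lia.
rewrite !inE => /and3P[xB' xB xA].
have [|y] := @exchange_base _ M B B' x BM B'M; first by rewrite !inE xB'.
rewrite !inE => /andP[yB yB'] B2M.
(* An incoming [y] in [A] would give a base with more elements in [A] than [B]. *)
have yA : y \notin A.
  apply: contraT; rewrite negbK => yA; have := maxA _ B2M.
  have -> : (y |: B :\ x) :&: A = y |: (B :&: A).
    apply/setP=> z; rewrite !inE; have [->|_ /=] := eqVneq z y; first by rewrite yA.
    by have [->|//] := eqVneq z x; rewrite (negbTE xA) !andbF.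
  by rewrite cardsU1 !inE (negbTE yB) /= add1n ltnn.
have eqBA : (y |: B :\ x) :&: A = B :&: A.
  apply/setP=> z; rewrite !inE; have [->|_ /=] := eqVneq z y.
    by rewrite (negbTE yA) !andbF.
  by have [->|//] := eqVneq z x; rewrite (negbTE xA) !andbF.
rewrite -eqBA; apply: IHn => //; rewrite ?eqBA //.
rewrite ltnS in lt_n; apply: leq_trans lt_n; apply: proper_card.
apply/properP; split; last first.
  exists x; rewrite !inE ?xB' ?xB //= eqxx orbF xA /= andbT.
  by apply: contraNneq xB' => ->.
apply/subsetP=> z; rewrite !inE => /and3P[zB' /orP[/eqP zy|/andP[_ ->]] ->].
  by rewrite zy yB' in zB'.
by rewrite zB'.
Qed.

(* The connectivity r(X) + r(E - X) - r(E) of [X] in [S] is at most 1. *)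
Definition thin S X : Prop :=
  forall B B', B \in bases S -> B' \in bases S -> #|B :&: X| <= #|B' :&: X|.+1.

(** Together with [rk_weak] the last clause is an equality of ranks. *)
Definition thin_le M S : Prop :=
  [/\ ground M = ground S, bases M \subset bases S
    & forall X, thin S X -> rk S X <= rk M X].

(** [thin_le Z S] is not demanded: it follows by [rk_weak] from the two inclusions that place [Z]
    between [M] and [S]. *)
Definition has_joins S : Prop :=
  forall M N, thin_le M S -> thin_le N S ->
  exists Z, [/\ ground Z = ground S, bases Z \subset bases S,
    bases M \subset bases Z, bases N \subset bases Z
    & forall W, thin_le W S -> bases M \subset bases W -> bases N \subset bases W ->
      bases Z \subset bases W].

Lemma thin_set1 S x : thin S [set x].
Proof.
move=> B B' _ _; apply: leq_trans (subset_leq_card (subsetIr _ _)) _.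
by rewrite cards1.
Qed.

Lemma thin_le_indep M S I : thin_le M S -> #|I| <= 1 -> indep S I -> indep M I.
Proof.
case=> _ _ thinM; case: (set_0Vmem I) => [->|[x xI]] I1 indI.
  by have /set0Pn[B BM] := bases_neq0 M; apply/indepP; exists B; rewrite ?sub0set.
have I_x : I = [set x].
  by apply/esym/eqP; rewrite eqEcard sub1set xI cards1.
apply: indep_rk; apply/eqP; rewrite eqn_leq rk_le_card /= -(rk_indep indI).
by rewrite I_x; apply/thinM/thin_set1.
Qed.

Lemma has_joins_rank2 S : mrank S <= 2 -> has_joins S.
Proof.
move=> rS M N MS NS.
have [gM sM _] := MS; have [gN sN _] := NS.
have cardS B : B \in bases S -> #|B| <= 2 by move=> BS; rewrite -(mrankE BS).
have sMN B : B \in bases M :|: bases N -> B \in bases S.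
  by rewrite inE => /orP[/(subsetP sM)|/(subsetP sN)].
(* [B1] need only be a base of [S]: what remains of it without [x] has at most one element, so its
   independence passes from [S] to [L]. Hence mixed pairs, one base from [M] and one from [N], can
   be exchanged too, and the result belongs to the owner of [B2]. *)
have exch L B1 B2 x : thin_le L S -> B1 \in bases S -> B2 \in bases L ->
    x \in B1 :\: B2 -> exists2 y, y \in B2 :\: B1 & y |: B1 :\ x \in bases L.
  move=> LS B1S B2L; rewrite inE => /andP[xB2 xB1]; have [_ sL _] := LS.
  have cB1 := cardsD1 x B1; rewrite xB1 in cB1.
  have indU : indep L (B1 :\ x).
    apply: (thin_le_indep LS).
      by have := cardS _ B1S; lia.
    by apply: indepS (base_indep B1S); apply: subD1set.
  have [B BL [sUB sBU]] := indep_extend indU B2L.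
  have cB : #|B| = #|B1| by apply: card_base (subsetP sL _ BL) B1S.
  have [y yB yU] : exists2 y, y \in B & y \notin B1 :\ x.
    by apply/subsetPn; apply: contraL (ltnSn #|B|) => /subset_leq_card; lia.
  have yB2 : y \in B2.
    by have := subsetP sBU _ yB; rewrite in_setU (negbTE yU).
  exists y.
    rewrite inE yB2 andbT; apply: contra yU => yB1; rewrite !inE yB1 andbT.
    by apply: contraNneq xB2 => <-.
  suff -> : y |: B1 :\ x = B by [].
  apply/eqP; rewrite eqEcard subUset sub1set yB sUB /=.
  by rewrite cardsU1 yU; lia.
have [|||Z [gZ bZ]] := @matroid_exists (ground S) (bases M :|: bases N).
- by move=> B /sMN/baseS.
- by have /set0Pn[B BM] := bases_neq0 M; exists B; rewrite inE BM.
- move=> B1 B2 x /sMN B1S /setUP[B2L|B2L] xB.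
    by have [y yB BL] := exch M _ _ _ MS B1S B2L xB; exists y; rewrite // in_setU BL.
  by have [y yB BL] := exch N _ _ _ NS B1S B2L xB; exists y; rewrite // in_setU BL orbT.
exists Z; split=> //; rewrite bZ ?subsetUl ?subsetUr //.
  by apply/subsetP=> B /sMN.
by move=> W _ MW NW; rewrite subUset MW.
Qed.

Lemma basesC M B : B \in bases M -> ground M :\: B \in bases (dual M).
Proof. exact: imset_f. Qed.

Lemma basesCE M B : B \in bases (dual M) ->
  B \subset ground M /\ ground M :\: B \in bases M.
Proof.
case/imsetP=> B' B'M ->; rewrite subsetDl setDDr setDv set0U.
by rewrite (setIidPr (baseS B'M)).
Qed.

Lemma bases_dualK M : bases (dual (dual M)) = bases M.
Proof.
have dualK B : B \in bases M -> ground M :\: (ground M :\: B) = B.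
  by move=> BM; rewrite setDDr setDv set0U (setIidPr (baseS BM)).
apply/setP=> B; apply/idP/idP=> [/imsetP[_ /imsetP[B' B'M ->] ->]|BM].
  by rewrite /= dualK.
by rewrite -[B]dualK //; do 2! apply: imset_f.
Qed.

Lemma dual_weak M N : ground M = ground N -> bases M \subset bases N ->
  bases (dual M) \subset bases (dual N).
Proof. by move=> eqE sMN; rewrite /= /cobases eqE; apply: imsetS. Qed.

(** A base and its complement together cover [X] exactly once within the ground set, and all bases
    have the same size. So passing from [X] in the dual to [~: X] in [S] shifts all intersection
    sizes by one constant, which preserves both thinness and the comparison of ranks. *)
Lemma thin_le_dual M S : thin_le M S -> thin_le (dual M) (dual S).
Proof.
case=> gM sM thinM; split=> //; first exact: dual_weak.
have cardC B X : B \in bases S ->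
    #|ground S :&: X| + #|B| = #|(ground S :\: B) :&: X| + #|B :&: X| + #|B|.
  move=> BS; have := cardsID B (ground S :&: X).
  have -> : ground S :&: X :&: B = B :&: X.
    by rewrite setIAC (setIidPr (baseS BS)).
  by rewrite setIDAC; lia.
move=> X thinX; have thinCX : thin S (~: X).
  move=> B B' BS B'S.
  have := thinX _ _ (basesC BS) (basesC B'S).
  have := cardC B X BS; have := cardC B' X B'S.
  have := cardsID X B; have := cardsID X B'; rewrite !setDE.
  by have := card_base BS B'S; lia.
have [B' B'M rkB'] := rk_attained M (~: X).
have [B BS rkB] := rk_attained (dual S) X.
have [sB cB] := basesCE BS.
have B'S := subsetP sM _ B'M.
apply: leq_trans (rk_base X (basesC B'M)); rewrite -rkB gM.
have := leq_trans (rk_base (~: X) cB) (thinM _ thinCX); rewrite -rkB'.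
have := cardC _ X cB; have := cardC B' X B'S.
have := cardsID X (ground S :\: B); have := cardsID X B'; rewrite !(setDE _ X).
have -> : ground S :\: (ground S :\: B) = B.
  by rewrite setDDr setDv set0U (setIidPr sB).
by have := card_base cB B'S; lia.
Qed.

Lemma has_joins_dual S : has_joins (dual S) -> has_joins S.
Proof.
move=> JS M N MS NS; have [gM _ _] := MS; have [gN _ _] := NS.
have [Z [gZ sZ MZ NZ leZ]] := JS _ _ (thin_le_dual MS) (thin_le_dual NS).
exists (dual Z); split=> //.
- by rewrite -(bases_dualK S); apply: dual_weak.
- by rewrite -(bases_dualK M); apply: dual_weak; rewrite //= gM.
- by rewrite -(bases_dualK N); apply: dual_weak; rewrite //= gN.
move=> W WS MW NW; have [gW _ _] := WS.
rewrite -(bases_dualK W); apply: dual_weak; rewrite ?gZ ?gW //.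
apply: leZ; first exact: thin_le_dual.
  by apply: dual_weak; rewrite // gM.
by apply: dual_weak; rewrite // gN.
Qed.

Lemma has_joins_small S : mrank S <= 2 \/ mcorank S <= 2 -> has_joins S.
Proof.
by case=> [|?]; [|apply: has_joins_dual]; apply: has_joins_rank2.
Qed.

End Joins.

(** * Direct sums *)

Section DirectSum.

Variable T : finType.
Implicit Types (M N S W Z : matroid T) (A B C D I J X Y : {set T}) (x y z e : T).

Lemma restriction_exists M A k :
  (forall B, B \in bases M -> #|B :&: A| = k) ->
  exists M', ground M' = ground M :&: A /\
    bases M' = [set B :&: A | B in bases M].
Proof.
move=> cA; apply: matroid_exists.
- by move=> _ /imsetP[B /baseS sB ->]; apply: setSI.
- by have /set0Pn[B BM] := bases_neq0 M; exists (B :&: A); apply: imset_f.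
move=> _ _ x /imsetP[B BM ->] /imsetP[B' B'M ->].
rewrite !inE negb_and => /andP[+ /andP[xB xA]]; rewrite xA orbF => xB'.
(* Once the first base agrees with [B'] outside [A], the element obtained by exchange must lie in
   [A]. *)
have B2M : (B :&: A) :|: (B' :&: ~: A) \in bases M.
  by apply: splice; rewrite ?cA // => B'' ?; rewrite !cA.
have [|y] := @exchange_base _ M _ B' x B2M B'M; first by rewrite !inE xB xA xB'.
rewrite !inE negb_or !negb_and negbK => /andP[/andP[yB yA] yB'] B3M.
have {}yA : y \in A by rewrite yB' in yA.
have {}yB : y \notin B by rewrite yA orbF in yB.
exists y; first by rewrite !inE (negbTE yB) yB' yA.
apply/imsetP; exists (y |: ((B :&: A) :|: (B' :&: ~: A)) :\ x) => //.
apply/setP=> z; rewrite !inE.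
have [->|_ /=] := eqVneq z y; first by rewrite yA.
by case: (z \in A); rewrite ?andbF ?andbT ?orbF.
Qed.

Lemma is_direct_sumC S1 S2 S : is_direct_sum S1 S2 S -> is_direct_sum S2 S1 S.
Proof.
case=> dis gS bS; split; rewrite ?gS 1?setUC 1?disjoint_sym // bS.
by apply/setP=> B; apply/imset2P/imset2P=> -[B1 B2 B1S B2S ->]; exists B2 B1; rewrite // setUC.
Qed.

Lemma direct_sum_partl S1 S2 B1 B2 :
  [disjoint ground S1 & ground S2] -> B1 \in bases S1 -> B2 \in bases S2 ->
  (B1 :|: B2) :&: ground S1 = B1.
Proof.
move=> dis /baseS/setIidPl sB1 /baseS sB2; rewrite setIUl sB1.
suff -> : B2 :&: ground S1 = set0 by rewrite setU0.
by apply/disjoint_setI0; rewrite disjoint_sym (disjointWr sB2).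
Qed.

(** Bases of [M] are bases of [S], so all meet [ground S1] in [mrank S1] elements and [M] restricts
    there. A thin set of [S1], cut down to [ground S1], is thin in [S], which carries over the rank
    condition. *)
Lemma thin_le_direct_sum S1 S2 S M :
  is_direct_sum S1 S2 S -> thin_le M S ->
  exists M1, thin_le M1 S1 /\ bases M1 = [set B :&: ground S1 | B in bases M].
Proof.
case=> dis gS bS [gM sM thinM].
have partS B : B \in bases S -> B :&: ground S1 \in bases S1.
  by rewrite bS => /imset2P[B1 B2 B1S B2S ->]; rewrite (direct_sum_partl dis B1S B2S).
have liftS B1 : B1 \in bases S1 -> exists2 B, B \in bases S & B :&: ground S1 = B1.
  have /set0Pn[B2 B2S] := bases_neq0 S2 => B1S; exists (B1 :|: B2).
    by rewrite bS; apply: imset2_f.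
  exact: direct_sum_partl B1S B2S.
have [|M1 [gM1 bM1]] := @restriction_exists M (ground S1) (mrank S1).
  by move=> B /(subsetP sM)/partS/mrankE->.
exists M1; split=> //; split.
- by rewrite gM1 gM gS setIUl setIid; apply/setUidPl/subsetIr.
- by rewrite bM1; apply/subsetP=> _ /imsetP[B BM ->]; apply/partS/(subsetP sM).
move=> X thinX; have thinXS : thin S (X :&: ground S1).
  move=> B B' /partS BS /partS B'S.
  by rewrite [X :&: _]setIC !setIA; apply: thinX.
have [B1 B1S <-] := rk_attained S1 X.
have [B BS defB1] := liftS B1 B1S.
rewrite -defB1 -setIA [_ :&: X]setIC.
apply: leq_trans (rk_base _ BS) _; apply: leq_trans (thinM _ thinXS) _.
have [B' B'M <-] := rk_attained M (X :&: ground S1).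
rewrite [X :&: _]setIC setIA; apply: rk_base.
by rewrite bM1; apply: imset_f.
Qed.

Lemma direct_sum_exists M1 M2 : [disjoint ground M1 & ground M2] ->
  exists M, is_direct_sum M1 M2 M.
Proof.
move=> dis.
have [|||M [gM bM]] := @matroid_exists _ (ground M1 :|: ground M2)
    [set B1 :|: B2 | B1 in bases M1, B2 in bases M2].
- by move=> _ /imset2P[B1 B2 /baseS ? /baseS ? ->]; apply: setUSS.
- have /set0Pn[B1 B1M] := bases_neq0 M1; have /set0Pn[B2 B2M] := bases_neq0 M2.
  by exists (B1 :|: B2); apply: imset2_f.
- move=> _ _ x /imset2P[B1 B2 B1M B2M ->] /imset2P[C1 C2 C1M C2M ->].
  have dis1 z : z \in ground M1 -> z \in ground M2 -> False.
    by move=> z1 z2; have /setP/(_ z) := disjoint_setI0 dis; rewrite !inE z1 z2.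
  have sub1 B z : B \in bases M1 -> z \in B -> z \in ground M1.
    by move=> /baseS/subsetP; apply.
  have sub2 B z : B \in bases M2 -> z \in B -> z \in ground M2.
    by move=> /baseS/subsetP; apply.
  rewrite !inE negb_or => /andP[/andP[xC1 xC2] /orP[xB1|xB2]].
    have [|y] := @exchange_base _ M1 _ _ x B1M C1M; first by rewrite inE xC1.
    rewrite inE => /andP[yB1 yC1] BM.
    have yB2 : y \notin B2 by apply/negP=> /(sub2 _ _ B2M); apply: dis1; apply: sub1 C1M _.
    have xB2 : x \notin B2 by apply/negP=> /(sub2 _ _ B2M); apply: dis1; apply: sub1 B1M _.
    exists y; first by rewrite !inE negb_or yB1 yB2 yC1.
    apply/imset2P; exists (y |: B1 :\ x) B2 => //; apply/setP=> z; rewrite !inE.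
    by have [->|_ /=] := eqVneq z x; rewrite ?(negbTE xB2) ?orbF //= orbA.
  have [|y] := @exchange_base _ M2 _ _ x B2M C2M; first by rewrite inE xC2.
  rewrite inE => /andP[yB2 yC2] BM.
  have yB1 : y \notin B1.
    by apply/negP=> /(sub1 _ _ B1M) y1; apply: dis1 y1 (sub2 _ _ C2M yC2).
  have xB1 : x \notin B1.
    by apply/negP=> /(sub1 _ _ B1M) x1; apply: dis1 x1 (sub2 _ _ B2M xB2).
  exists y; first by rewrite !inE negb_or yB1 yB2 yC2 orbT.
  apply/imset2P; exists B1 (y |: B2 :\ x) => //; apply/setP=> z; rewrite !inE.
  by have [->|_ /=] := eqVneq z x; rewrite ?(negbTE xB1) ?orbF //= orbCA.
by exists M.
Qed.

Lemma has_joins_direct_sum S1 S2 S :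
  is_direct_sum S1 S2 S -> has_joins S1 -> has_joins S2 -> has_joins S.
Proof.
move=> dS J1 J2 M N MS NS; have dS' := is_direct_sumC dS.
have [dis gS bS] := dS.
have [M1 [MS1 bM1]] := thin_le_direct_sum dS MS.
have [M2 [MS2 bM2]] := thin_le_direct_sum dS' MS.
have [N1 [NS1 bN1]] := thin_le_direct_sum dS NS.
have [N2 [NS2 bN2]] := thin_le_direct_sum dS' NS.
have [Z1 [gZ1 sZ1 MZ1 NZ1 leZ1]] := J1 _ _ MS1 NS1.
have [Z2 [gZ2 sZ2 MZ2 NZ2 leZ2]] := J2 _ _ MS2 NS2.
have [|Z [_ gZ bZ]] := @direct_sum_exists Z1 Z2; first by rewrite gZ1 gZ2.
have leZ L L1 L2 : thin_le L S -> bases L1 = [set B :&: ground S1 | B in bases L] ->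
    bases L2 = [set B :&: ground S2 | B in bases L] ->
    bases L1 \subset bases Z1 -> bases L2 \subset bases Z2 -> bases L \subset bases Z.
  move=> [gL sL _] bL1 bL2 LZ1 LZ2; apply/subsetP=> B BL; rewrite bZ.
  have -> : B = (B :&: ground S1) :|: (B :&: ground S2).
    by rewrite -setIUr -gS (setIidPl (baseS (subsetP sL _ BL))).
  apply: imset2_f; [apply: (subsetP LZ1) | apply: (subsetP LZ2)].
    by rewrite bL1; apply: imset_f.
  by rewrite bL2; apply: imset_f.
exists Z; split; rewrite ?gZ ?gZ1 ?gZ2 //.
- rewrite bZ bS; apply/subsetP=> _ /imset2P[B1 B2 B1Z B2Z ->].
  by apply: imset2_f; [apply: (subsetP sZ1)|apply: (subsetP sZ2)].
- exact: leZ bM1 bM2 MZ1 MZ2.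
- exact: leZ bN1 bN2 NZ1 NZ2.
move=> W WS MW NW; have [gW sW _] := WS.
have [W1 [WS1 bW1]] := thin_le_direct_sum dS WS.
have [W2 [WS2 bW2]] := thin_le_direct_sum dS' WS.
have ZW1 : bases Z1 \subset bases W1.
  by apply: leZ1 => //; rewrite bW1 ?bM1 ?bN1; apply: imsetS.
have ZW2 : bases Z2 \subset bases W2.
  by apply: leZ2 => //; rewrite bW2 ?bM2 ?bN2; apply: imsetS.
rewrite bZ; apply/subsetP=> _ /imset2P[B1 B2 /(subsetP ZW1) + /(subsetP ZW2) + ->].
rewrite bW1 bW2 => /imsetP[B BW ->] /imsetP[B' B'W ->].
have cW K : K \in bases W -> #|K :&: ground S1| = mrank S1.
  move=> /(subsetP sW); rewrite bS => /imset2P[K1 K2 K1S K2S ->].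
  by rewrite (direct_sum_partl dis K1S K2S) -(mrankE K1S).
(* The two halves come from different bases of [W]. They splice because all bases of [W] have
   equally many elements in [ground S1]. *)
suff -> : B' :&: ground S2 = B' :&: ~: ground S1.
  by apply: splice => //; [|move=> K KW]; rewrite !cW.
apply/setP=> z; rewrite !inE; case zB': (z \in B') => //=.
have : z \in ground S by apply: (subsetP (baseS (subsetP sW _ B'W))).
have /setP/(_ z) := disjoint_setI0 dis; rewrite gS !inE.
by case: (z \in ground S1); case: (z \in ground S2).
Qed.

End DirectSum.

(** * 2-sums *)

Section TwoSum.

Variable T : finType.
Implicit Types (M N S W Z : matroid T) (A B C D I J X Y : {set T}) (x y z e : T).

(* The base that [B] induces on the summand of a 2-sum with ground set [e |: A] and
   rank [r]; it contains the basepoint [e] when [B] is one short of [r] on [A]. *)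
Definition part A e r B : {set T} :=
  if #|B :&: A| == r then B :&: A else e |: (B :&: A).

(** The exchange property is checked in four cases, according to whether each of the two bases is
    full on [A] (has [r] elements there) or one short. *)
Lemma part_exists M A e r : e \notin A ->
  (forall B, B \in bases M -> #|B :&: A| <= r <= #|B :&: A|.+1) ->
  exists M', ground M' = e |: (ground M :&: A) /\
    bases M' = [set part A e r B | B in bases M].
Proof.
move=> eA rA; apply: matroid_exists.
- move=> _ /imsetP[B /baseS sB ->]; rewrite /part.
  case: ifP => _; last by apply/setUS/setSI.
  by apply: subset_trans (setSI A sB) (subsetUr _ _).
- by have /set0Pn[B BM] := bases_neq0 M; exists (part A e r B); apply: imset_f.
have swapA B x y : x \in A -> y \in A -> (y |: B :\ x) :&: A = y |: (B :&: A) :\ x.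
  move=> xA yA; apply/setP=> z; rewrite !inE.
  by have [->|_ /=] := eqVneq z y; rewrite ?yA //= andbA.
have neA B : e \notin B :&: A by rewrite inE (negbTE eA) andbF.
move=> _ _ x /imsetP[B BM ->] /imsetP[B' B'M ->].
have cBB' := card_base BM B'M.
rewrite {2}/part {1}/part.
case: (altP (#|B' :&: A| =P r)) => pB'; case: (altP (#|B :&: A| =P r)) => pB.
- rewrite !inE negb_and => /andP[+ /andP[xB xA]]; rewrite xA orbF => xB'.
  have B2M : (B :&: A) :|: (B' :&: ~: A) \in bases M.
    by apply: splice; rewrite ?pB ?pB' // => B'' B''M; have /andP[] := rA _ B''M.
  have [|y] := @exchange_base _ M _ B' x B2M B'M; first by rewrite !inE xB xA xB'.
  rewrite !inE negb_or !negb_and negbK => /andP[/andP[yB yA] yB'] B3M.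
  have {}yA : y \in A by rewrite yB' in yA.
  have {}yB : y \notin B by rewrite yA orbF in yB.
  exists y; first by rewrite /part pB pB' eqxx !inE (negbTE yB) yB' yA.
  apply/imsetP; exists (y |: ((B :&: A) :|: (B' :&: ~: A)) :\ x) => //.
  rewrite /part swapA // setIUl -!setIA setIid [~: A :&: A]setIC setICr setI0 setU0 pB eqxx.
  by rewrite card_swap ?pB ?eqxx // !inE ?xB // negb_and yB.
- rewrite inE in_setU1 !inE negb_and => /andP[xB' /orP[/eqP->|/andP[xB xA]]].
    (* The outgoing element is the basepoint. Extending [B :&: A] by [B'] gives a base with no more
       elements outside [A] than [B'], hence full on [A]; its one new element in [A] replaces
       [e]. *)
    have [K KM [sBK sKB']] := indep_extend (indepS (subsetIl B A) (base_indep BM)) B'M.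
    have cK : #|K :\: A| <= #|B' :\: A|.
      apply/subset_leq_card/subsetP=> z; rewrite !inE => /andP[zA /(subsetP sKB')].
      by rewrite !inE (negbTE zA) andbF.
    have cKA : #|K :&: A| = r.
      have := cardsID A K; have := cardsID A B'.
      by have := card_base KM B'M; have := rA _ KM; move: cK pB' cBB'; clear; lia.
    have cBA : #|B :&: A|.+1 = r by have := rA _ BM; move: pB; clear; lia.
    have sBKA : B :&: A \subset K :&: A by rewrite subsetI sBK subsetIr.
    have [y yK yB] : exists2 y, y \in K :&: A & y \notin B :&: A.
      apply/subsetPn; apply: contraL (ltnSn #|K :&: A|) => /subset_leq_card.
      by rewrite cKA -cBA ltnS leqNgt.
    move: (yK); rewrite inE => /andP[yK1 yA].
    have yB' : y \in B'.
      by have := subsetP sKB' _ yK1; rewrite in_setU (negbTE yB).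
    have ye : y != e by apply: contraNneq eA => <-.
    exists y.
      by rewrite /part (negbTE pB) pB' eqxx inE in_setU1 (negbTE yB) (negbTE ye) inE yB' yA.
    apply/imsetP; exists K => //; rewrite /part cKA eqxx (negbTE pB) setU1K //.
    by apply/eqP; rewrite eqEcard subUset sub1set yK sBKA /= cardsU1 yB cKA -cBA.
  have {}xB' : x \notin B' by rewrite xA orbF in xB'.
  have [|y] := @exchange_base _ M B B' x BM B'M; first by rewrite !inE xB'.
  rewrite inE => /andP[yB yB'] B3M.
  (* An incoming [y] outside [A] would leave the base two short on [A]. *)
  have yA : y \in A.
    apply: contraT => yA; have := rA _ B3M.
    have -> : (y |: B :\ x) :&: A = (B :&: A) :\ x.
      apply/setP=> z; rewrite !inE; have [->|_ /=] := eqVneq z y; last by rewrite andbA.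
      by rewrite (negbTE yA) !andbF.
    have := cardsD1 x (B :&: A); rewrite inE xB xA; have := rA _ BM.
    move: pB; clear; lia.
  have ye : y != e by apply: contraNneq eA => <-.
  have xe : x != e by apply: contraNneq eA => <-.
  exists y; first by rewrite /part (negbTE pB) pB' eqxx !inE (negbTE yB) (negbTE ye) yB' yA.
  apply/imsetP; exists (y |: B :\ x) => //.
  rewrite /part swapA // card_swap ?inE ?xB ?xA ?(negbTE yB) // (negbTE pB).
  apply/setP=> z; rewrite !inE; have [->|_ /=] := eqVneq z y; first by rewrite orbT.
  by have [->|//] := eqVneq z e; rewrite eq_sym xe.
- rewrite inE in_setU1 !inE negb_or => /andP[/andP[xe xB'] /andP[xB xA]].
  have {}xB' : x \notin B' by rewrite xA andbT in xB'.
  have [|y] := @exchange_base _ M B B' x BM B'M; first by rewrite !inE xB'.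
  rewrite inE => /andP[yB yB'] B3M.
  have [yA|yA] := boolP (y \in A).
    have ye : y != e by apply: contraNneq eA => <-.
    exists y; first by rewrite /part (negbTE pB') pB eqxx !inE (negbTE yB) yB' yA orbT.
    apply/imsetP; exists (y |: B :\ x) => //.
    by rewrite /part swapA // card_swap ?inE ?xB ?xA ?(negbTE yB) // pB eqxx.
  have eqA : (y |: B :\ x) :&: A = (B :&: A) :\ x.
    apply/setP=> z; rewrite !inE; have [->|_ /=] := eqVneq z y; last by rewrite andbA.
    by rewrite (negbTE yA) !andbF.
  (* Here [y] lies outside [A], so the new base is one short on [A] and the basepoint takes the
     place of [x]. *)
  exists e; first by rewrite /part (negbTE pB') pB eqxx !inE (negbTE eA) !andbF eqxx.
  apply/imsetP; exists (y |: B :\ x) => //; rewrite /part eqA pB eqxx.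
  have := cardsD1 x (B :&: A); rewrite inE xB xA pB.
  by case: eqP => // ->; clear; lia.
rewrite inE !in_setU1 !inE negb_or => /andP[/andP[xe xB']].
rewrite (negbTE xe) /= => /andP[xB xA].
have {}xB' : x \notin B' by rewrite xA andbT in xB'.
have [|y] := @exchange_base _ M B B' x BM B'M; first by rewrite !inE xB'.
rewrite inE => /andP[yB yB'] B3M.
have yA : y \in A.
  apply: contraT => yA; have := rA _ B3M.
  have -> : (y |: B :\ x) :&: A = (B :&: A) :\ x.
    apply/setP=> z; rewrite !inE; have [->|_ /=] := eqVneq z y; last by rewrite andbA.
    by rewrite (negbTE yA) !andbF.
  have := cardsD1 x (B :&: A); rewrite inE xB xA; have := rA _ BM.
  move: pB; clear; lia.
have ye : y != e by apply: contraNneq eA => <-.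
exists y; first by rewrite /part (negbTE pB) (negbTE pB') !inE (negbTE yB) (negbTE ye) yB' yA.
apply/imsetP; exists (y |: B :\ x) => //.
rewrite /part swapA // card_swap ?inE ?xB ?xA ?(negbTE yB) // (negbTE pB).
apply/setP=> z; rewrite !inE; have [->|_ /=] := eqVneq z y; first by rewrite orbT.
by have [->|//] := eqVneq z e; rewrite eq_sym xe.
Qed.

(** The bases of the 2-sum, whose definition is by circuits: exactly one of the two bases contains
    the basepoint. *)
Definition glue S1 S2 e : {set {set T}} :=
  [set (B.1 :|: B.2) :\ e | B in setX (bases S1) (bases S2)
                          & (e \in B.1) (+) (e \in B.2)].

Lemma glueP S1 S2 e B :
  reflect (exists B1 B2, [/\ B1 \in bases S1, B2 \in bases S2,
             (e \in B1) (+) (e \in B2) & B = (B1 :|: B2) :\ e])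
          (B \in glue S1 S2 e).
Proof.
apply: (iffP imsetP) => [[[B1 B2]]|[B1 [B2 [B1S B2S eB ->]]]].
  by rewrite !inE /= => /andP[/andP[? ?] ?] ->; exists B1, B2.
by exists (B1, B2); rewrite // !inE /= B1S B2S.
Qed.

Lemma glueC S1 S2 e : glue S1 S2 e = glue S2 S1 e.
Proof.
apply/setP=> B; apply/glueP/glueP=> -[B1 [B2 [? ? ? ->]]]; exists B2, B1;
  by split; rewrite 1?addbC // setUC.
Qed.

Lemma glue_exists M1 M2 e :
  ground M1 :&: ground M2 = [set e] -> glue M1 M2 e != set0 ->
  exists M, ground M = (ground M1 :|: ground M2) :\ e /\ bases M = glue M1 M2 e.
Proof.
move=> gI /set0Pn nz; apply: matroid_exists => //.
  by move=> _ /glueP[B1 [B2 [/baseS ? /baseS ? _ ->]]]; rewrite setSD ?setUSS.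
(* By [glueC] the outgoing element may be assumed to lie in the first summand. *)
suff exch N1 N2 B1 B2 C1 C2 x : ground N1 :&: ground N2 = [set e] ->
    B1 \in bases N1 -> B2 \in bases N2 -> C1 \in bases N1 -> C2 \in bases N2 ->
    (e \in B1) (+) (e \in B2) -> (e \in C1) (+) (e \in C2) ->
    x \in B1 -> x \notin C1 -> x != e ->
    exists2 y, y \in ((C1 :|: C2) :\ e) :\: ((B1 :|: B2) :\ e) &
      y |: ((B1 :|: B2) :\ e) :\ x \in glue N1 N2 e.
  move=> B C x /glueP[B1 [B2 [B1M B2M eB ->]]] /glueP[C1 [C2 [C1M C2M eC ->]]].
  rewrite !inE => /andP[+ /andP[xe xB]]; rewrite xe negb_or /= => /andP[xC1 xC2].
  case/orP: xB => xB; first exact: exch.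
  rewrite glueC (setUC B1) (setUC C1); by apply: exch; rewrite // 1?setIC // addbC.
move=> {}gI B1N B2N C1N C2N eB eC xB xC xe.
have inI z : z \in ground N1 -> z \in ground N2 -> z = e.
  by move=> z1 z2; have /setP/(_ z) := gI; rewrite !inE z1 z2 => /esym/eqP.
have sub1 B z : B \in bases N1 -> z \in B -> z \in ground N1.
  by move=> /baseS/subsetP; apply.
have sub2 B z : B \in bases N2 -> z \in B -> z \in ground N2.
  by move=> /baseS/subsetP; apply.
have xB2 : x \notin B2.
  by apply: contra xe => x2; apply/eqP/inI; [apply: sub1 B1N _|apply: sub2 B2N _].
have [|y] := @exchange_base _ N1 _ _ x B1N C1N; first by rewrite inE xC.
rewrite inE => /andP[yB1 yC1] B3N.
have [y_e|ye] := eqVneq y e; last first.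
  have yB2 : y \notin B2.
    by apply: contra ye => y2; apply/eqP/inI; [apply: sub1 C1N _|apply: sub2 B2N _].
  exists y; first by rewrite !inE ye yC1 negb_or yB1 yB2.
  apply/glueP; exists (y |: B1 :\ x), B2; split=> //.
    by rewrite !inE [e == y]eq_sym (negbTE ye) [e == x]eq_sym xe.
  apply/setP=> z; rewrite !inE; have [->|zy /=] := eqVneq z y; first by rewrite ye.
  by have [->|] := eqVneq z x; rewrite ?(negbTE xB2) ?andbF //= orbF.
(* The exchange in [N1] brought in the basepoint. Then [e] must leave [B2], and an exchange against
   [C2], which avoids [e], supplies the element that really enters. *)
move: yB1 yC1 B3N; rewrite {y}y_e => eB1 eC1 B3N.
have eB2 : e \in B2 by move: eB; rewrite (negbTE eB1).
have eC2 : e \notin C2 by move: eC; rewrite eC1.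
have [|y] := @exchange_base _ N2 _ _ e B2N C2N; first by rewrite inE eC2.
rewrite inE => /andP[yB2 yC2] B4N.
have ye : y != e by apply: contraNneq eC2 => <-.
have yB1 : y \notin B1.
  by apply: contra ye => y1; apply/eqP/inI; [apply: sub1 B1N _|apply: sub2 C2N _].
have xy : x != y.
  by apply: contraNneq yB1 => <-.
exists y; first by rewrite !inE ye yC2 orbT negb_or yB1 yB2.
apply/glueP; exists (e |: B1 :\ x), (y |: B2 :\ e); split=> //.
  by rewrite !inE eqxx [e == y]eq_sym (negbTE ye).
apply/setP=> z; rewrite !inE; have [->|zy /=] := eqVneq z y; first by rewrite ye orbT.
have [->|ze /=] := eqVneq z e; first by rewrite andbF.
by have [->|] := eqVneq z x; rewrite ?(negbTE xB2).
Qed.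

(** The last two clauses say, in terms of bases, that [e] is neither a loop nor a coloop of either
    summand. *)
Definition glued S1 S2 e S : Prop :=
  [/\ ground S1 :&: ground S2 = [set e],
      ground S = (ground S1 :|: ground S2) :\ e,
      bases S = glue S1 S2 e,
      (exists2 B, B \in bases S1 & e \in B) /\ (exists2 B, B \in bases S1 & e \notin B)
    & (exists2 B, B \in bases S2 & e \in B) /\ (exists2 B, B \in bases S2 & e \notin B)].

Lemma gluedC S1 S2 e S : glued S1 S2 e S -> glued S2 S1 e S.
Proof. by case=> gI gS bS e1 e2; split; rewrite 1?setIC 1?setUC 1?glueC. Qed.

Lemma not_loopP M e : e \in ground M -> ~~ loop M e ->
  exists2 B, B \in bases M & e \in B.
Proof.
move=> eM loopN; have /indepP[B BM] : indep M [set e].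
  apply: contraR loopN => dep_e; apply: dep_circuit; rewrite ?sub1set //.
  move=> c; rewrite inE => /eqP->; rewrite setDv.
  by have /set0Pn[B BM] := bases_neq0 M; apply: indepS (sub0set B) (base_indep BM).
by rewrite sub1set; exists B.
Qed.

Lemma not_coloopP M e : e \in ground M -> ~~ coloop M e ->
  exists2 B, B \in bases M & e \notin B.
Proof.
move=> eM /not_loopP[//|_ /imsetP[B BM ->]].
by rewrite inE => /andP[eB _]; exists B.
Qed.

(** The circuits determine the independent sets ([indS]); bases are then recognized among these by
    their size [mrank S1 + mrank S2 - 1]. *)
Lemma is_two_sum_glued S1 S2 S : is_two_sum S1 S2 S -> exists e, glued S1 S2 e S.
Proof.
case=> e [_ gI /and4P[l1 c1 l2 c2] gS cS]; exists e.
have [e1 e2] : e \in ground S1 /\ e \in ground S2.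
  by apply/andP; rewrite -in_setI gI inE.
split=> //; try by split; [apply: not_loopP|apply: not_coloopP].
have inI z : z \in ground S1 -> z \in ground S2 -> z = e.
  by move=> z1 z2; have /setP/(_ z) := gI; rewrite !inE z1 z2 => /esym/eqP.
pose A := ground S1 :\ e; pose G := ground S2 :\ e.
have circS C : C \in circuits S -> C \in two_sum_circuits S1 S2 e by rewrite cS.
have indS X : X \subset ground S -> indep S X =
    (indep S1 (e |: (X :&: A)) && indep S2 (X :&: G))
      || (indep S1 (X :&: A) && indep S2 (e |: (X :&: G))).
  move=> sX; apply/idP/idP=> [indX|]; last first.
    apply: contraTT => /(dependentP sX)[C /circS].
    rewrite /two_sum_circuits -setUA !in_setU.
    move=> + sCX; case/or3P=> [/setIdP[CS eC]|/setIdP[CS eC]|].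
    - have sCA : C \subset X :&: A.
        by rewrite subsetI sCX subsetD1 eC circuit_ground.
      rewrite negb_or !negb_and; apply/andP; split; apply/orP; left.
        by apply: contra (circuit_dep CS); apply/indepS/(subset_trans sCA)/subsetUr.
      by apply: contra (circuit_dep CS); apply: indepS sCA.
    - have sCG : C \subset X :&: G.
        by rewrite subsetI sCX subsetD1 eC circuit_ground.
      rewrite negb_or !negb_and; apply/andP; split; apply/orP; right.
        by apply: contra (circuit_dep CS); apply: indepS sCG.
      by apply: contra (circuit_dep CS); apply/indepS/(subset_trans sCG)/subsetUr.
    case/imset2P=> C1 C2 /setIdP[C1S eC1] /setIdP[C2S eC2] defC.
    have sub1 : C1 \subset e |: (X :&: A).
      apply/subsetP=> z zC1; rewrite !inE; have [//|ze /=] := eqVneq z e.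
      rewrite (subsetP (circuit_ground C1S)) // andbT (subsetP sCX) //.
      by rewrite defC !inE ze zC1.
    have sub2 : C2 \subset e |: (X :&: G).
      apply/subsetP=> z zC2; rewrite !inE; have [//|ze /=] := eqVneq z e.
      rewrite (subsetP (circuit_ground C2S)) // andbT (subsetP sCX) //.
      by rewrite defC !inE ze zC2 orbT.
    rewrite negb_or !negb_and; apply/andP; split; apply/orP; [left|right].
      by apply: contra (circuit_dep C1S); apply: indepS sub1.
    by apply: contra (circuit_dep C2S); apply: indepS sub2.
  have circX C : C \in two_sum_circuits S1 S2 e -> ~~ (C \subset X).
    by rewrite -cS => CS; apply: contra (circuit_dep CS) => /indepS; apply.
  have sA Y : Y \subset A -> Y \subset ground S1 by move/subset_trans; apply; apply: subD1set.
  have sG Y : Y \subset G -> Y \subset ground S2 by move/subset_trans; apply; apply: subD1set.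
  have ind1 : indep S1 (X :&: A).
    apply: contraT => /(dependentP (sA _ (subsetIr _ _)))[C CS].
    rewrite subsetI => /andP[sCX]; rewrite subsetD1 => /andP[_ eC].
    suff /circX : C \in two_sum_circuits S1 S2 e by rewrite sCX.
    rewrite /two_sum_circuits -setUA.
    by apply/setUP; left; apply/setIdP.
  have ind2 : indep S2 (X :&: G).
    apply: contraT => /(dependentP (sG _ (subsetIr _ _)))[C CS].
    rewrite subsetI => /andP[sCX]; rewrite subsetD1 => /andP[_ eC].
    suff /circX : C \in two_sum_circuits S1 S2 e by rewrite sCX.
    apply/setUP; left.
    by apply/setUP; right; apply/setIdP.
  (* If both alternatives failed, each side would have a circuit through [e] with its other elements
     in [X], and the two would combine to a circuit of [S] inside [X]. *)
  rewrite ind1 ind2 andbT /=; apply: contraT; rewrite negb_or => /andP[dep1 dep2].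
  have [|C1 C1S sC1] := dependentP _ dep1.
    by rewrite subUset sub1set e1 sA ?subsetIr.
  have [|C2 C2S sC2] := dependentP _ dep2.
    by rewrite subUset sub1set e2 sG ?subsetIr.
  have eC1 : e \in C1.
    apply: contraR (circuit_dep C1S) => eC1; apply: indepS ind1.
    by rewrite -(setU1K (_ : e \notin X :&: A)) ?inE ?eqxx ?andbF // subsetD1 sC1.
  have eC2 : e \in C2.
    apply: contraR (circuit_dep C2S) => eC2; apply: indepS ind2.
    by rewrite -(setU1K (_ : e \notin X :&: G)) ?inE ?eqxx ?andbF // subsetD1 sC2.
  suff /negP[] : ~~ ((C1 :|: C2) :\ e \subset X).
  apply/subsetP=> z; rewrite !inE => /andP[ze /orP[/(subsetP sC1)|/(subsetP sC2)]];
    by rewrite !inE (negbTE ze) /= => /andP[].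
  apply: circX; rewrite /two_sum_circuits !in_setU; apply/orP; right.
  by apply: imset2_f; apply/setIdP.
have splitS X : X \subset ground S -> #|X :&: A| + #|X :&: G| = #|X|.
  move=> sX; rewrite -cardsUI -setIUr -setDUl -gS (setIidPl sX).
  rewrite (_ : _ :&: _ = set0) ?cards0 ?addn0 //; apply/setP=> z; rewrite !inE.
  apply/negbTE; rewrite !negb_and !negbK.
  case: eqP => [|ze]; rewrite ?orbT //= -!negb_and; apply/negP.
  by case/andP=> /andP[_ z1] /andP[_ z2]; apply/ze/inI.
have indC B1 B2 B : B1 \in bases S1 -> B2 \in bases S2 -> (e \in B1) (+) (e \in B2) ->
    B = (B1 :|: B2) :\ e ->
    [/\ B \subset ground S, indep S B & (#|B|.+1 = mrank S1 + mrank S2)%N].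
  move=> B1S B2S eB defB.
  have sB : B \subset ground S.
    by rewrite defB gS setSD // setUSS ?baseS.
  have BA : B :&: A = B1 :\ e.
    rewrite defB; apply/setP=> z; rewrite !inE; have [//|ze /=] := eqVneq z e.
    apply/andP/idP=> [[/orP[//|z2 z1]]|zB1].
      by case/eqP: ze; apply: inI z1 (subsetP (baseS B2S) _ z2).
    by rewrite zB1 (subsetP (baseS B1S)).
  have BG : B :&: G = B2 :\ e.
    rewrite defB; apply/setP=> z; rewrite !inE; have [//|ze /=] := eqVneq z e.
    apply/andP/idP=> [[/orP[z1 z2|//]]|zB2].
      by case/eqP: ze; apply: inI (subsetP (baseS B1S) _ z1) z2.
    by rewrite zB2 orbT (subsetP (baseS B2S)).
  split=> //.
    rewrite indS // BA BG; move: eB.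
    case eB1: (e \in B1) => /= eB2.
      by rewrite setD1K // base_indep //= (indepS _ (base_indep B2S)) // subD1set.
    rewrite (setD1K eB2) (base_indep B2S) (indepS (subD1set B1 e) (base_indep B1S)).
    by rewrite orbT.
  rewrite -splitS // BA BG (mrankE B1S) (mrankE B2S) (cardsD1 e B1) (cardsD1 e B2).
  by case: (e \in B1) eB => /= eB; rewrite ?(negbTE eB) ?eB; clear; lia.
(* A base of [S1] through [e] and a base of [S2] avoiding [e] give an independent set of this size;
   [indS] shows that no independent set is larger. *)
have [B0 B0S cB0] : exists2 B0, B0 \in bases S & (#|B0|.+1 = mrank S1 + mrank S2)%N.
  have [B1 B1S eB1] := not_loopP e1 l1; have [B2 B2S eB2] := not_coloopP e2 c2.
  have [|_ /indepP[B0 B0S sB0] cB] := indC B1 B2 _ B1S B2S _ erefl.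
    by rewrite eB1 (negbTE eB2).
  exists B0 => //; apply/eqP; rewrite eqn_leq -{2}cB ltnS subset_leq_card // andbT.
  have := indS B0 (baseS B0S); rewrite base_indep //= => /esym.
  rewrite -(splitS B0) ?baseS // (mrankE B1S) (mrankE B2S).
  have eNA : e \notin B0 :&: A by rewrite !inE eqxx andbF.
  have eNG : e \notin B0 :&: G by rewrite !inE eqxx andbF.
  case/orP=> /andP[/indepP[D1 D1S /subset_leq_card s1] /indepP[D2 D2S /subset_leq_card s2]];
    move: s1 s2; rewrite cardsU1 ?eNA ?eNG (card_base D1S B1S) (card_base D2S B2S); clear; lia.
apply/setP=> B; apply/idP/glueP=> [BS|[B1 [B2 [B1S B2S eB defB]]]]; last first.
  have [_ indB cB] := indC _ _ _ B1S B2S eB defB.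
  by apply: indep_baseP B0S indB _; move: cB cB0; clear; lia.
have := indS B (baseS BS); rewrite base_indep // => /esym.
have := splitS B (baseS BS); have := card_base BS B0S.
have eNA : e \notin B :&: A by rewrite !inE eqxx andbF.
have eNG : e \notin B :&: G by rewrite !inE eqxx andbF.
have defB : B = (B :&: A) :|: (B :&: G).
  by rewrite -setIUr -setDUl -gS (setIidPl (baseS BS)).
have eB : e \notin B.
  by apply/negP=> /(subsetP (baseS BS)); rewrite gS !inE eqxx.
have [D1 D1S _] := not_loopP e1 l1; have [D2 D2S _] := not_loopP e2 l2.
have le1 I := @indep_le_rk _ S1 I (ground S1); have le2 I := @indep_le_rk _ S2 I (ground S2).
rewrite (mrankE D1S) (mrankE D2S) in cB0.
move=> cBB0 cB /orP[] /andP[i1 i2].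
  have := le1 _ i1 (indep_ground i1); have := le2 _ i2 (indep_ground i2).
  rewrite (rk_ground D1S) (rk_ground D2S) cardsU1 eNA => l2' l1'.
  exists (e |: (B :&: A)), (B :&: G); split.
  - by apply: indep_baseP D1S i1 _; rewrite cardsU1 eNA; move: cB cBB0 cB0 l1' l2'; clear; lia.
  - by apply: indep_baseP D2S i2 _; move: cB cBB0 cB0 l1' l2'; clear; lia.
  - by rewrite setU11 (negbTE eNG).
  - by rewrite -setUA -defB setU1K.
have := le1 _ i1 (indep_ground i1); have := le2 _ i2 (indep_ground i2).
rewrite (rk_ground D1S) (rk_ground D2S) cardsU1 eNG => l2' l1'.
exists (B :&: A), (e |: (B :&: G)); split.
- by apply: indep_baseP D1S i1 _; move: cB cBB0 cB0 l1' l2'; clear; lia.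
- by apply: indep_baseP D2S i2 _; rewrite cardsU1 eNG; move: cB cBB0 cB0 l1' l2'; clear; lia.
- by rewrite setU11 (negbTE eNA).
- by rewrite setUCA -defB setU1K.
Qed.

End TwoSum.

(** * Joins in 2-sums *)

Section TwoSumJoins.

Variable T : finType.
Implicit Types (M N S W Z : matroid T) (A B C D I J X Y : {set T}) (x y z e : T).

Lemma glued_partl S1 S2 e S B1 B2 : glued S1 S2 e S ->
  B1 \in bases S1 -> B2 \in bases S2 -> ((B1 :|: B2) :\ e) :&: (ground S1 :\ e) = B1 :\ e.
Proof.
case=> gI _ _ _ _ /baseS/subsetP sB1 /baseS/subsetP sB2.
apply/setP=> z; rewrite !inE; have [//|ze /=] := eqVneq z e.
apply/andP/idP=> [[/orP[//|/sB2 z2 z1]]|zB1]; last by rewrite zB1 sB1.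
by have /setP/(_ z) := gI; rewrite !inE z1 z2 (negbTE ze).
Qed.

Lemma part_glued S1 S2 e S B1 B2 : glued S1 S2 e S ->
  B1 \in bases S1 -> B2 \in bases S2 ->
  part (ground S1 :\ e) e (mrank S1) ((B1 :|: B2) :\ e) = B1.
Proof.
move=> gl B1S B2S; rewrite /part (glued_partl gl B1S B2S) (mrankE B1S).
rewrite (cardsD1 e B1); have [eB|eB] := boolP (e \in B1).
  by rewrite -{1}[#|_|]add0n eqn_add2r setD1K.
rewrite add0n eqxx; apply/setP=> z; rewrite !inE.
by have [->|//] := eqVneq z e; rewrite (negbTE eB).
Qed.

(* [lift_thin S1 S2 e X] is [X] with the basepoint expanded to the other part. *)
Definition lift_thin S1 S2 e X : {set T} :=
  X :&: (ground S1 :\ e) :|: (if e \in X then ground S2 :\ e else set0).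

(** Since exactly one of [B1] and [B2] contains [e], the size of [B2 :\ e] is [mrank S2 - 1], plus 1
    if [e] is in [B1]: up to a constant, the other summand counts the basepoint. The correction is
    added on the left to avoid truncated subtraction. *)
Lemma card_lift_thin S1 S2 e S B1 B2 X : glued S1 S2 e S ->
  B1 \in bases S1 -> B2 \in bases S2 -> (e \in B1) (+) (e \in B2) ->
  #|((B1 :|: B2) :\ e) :&: lift_thin S1 S2 e X| + (e \in X)
    = #|B1 :&: X| + (e \in X) * mrank S2.
Proof.
move=> gl B1S B2S eB; rewrite /lift_thin; set B := _ :\ e.
have cB1 : #|B1 :&: X| = #|B1 :&: X :\ e| + ((e \in B1) && (e \in X)).
  by rewrite (cardsD1 e (B1 :&: X)) inE addnC.
have BA : B :&: (X :&: (ground S1 :\ e)) = B1 :&: X :\ e.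
  by rewrite setICA (glued_partl gl B1S B2S) setIDA setIC.
case: ifP => eX; last first.
  by rewrite setU0 BA cB1 eX andbF mul0n !addn0.
have BG : B :&: (ground S2 :\ e) = B2 :\ e.
  by rewrite /B setUC (glued_partl (gluedC gl) B2S B1S).
have gI : ground S1 :&: ground S2 = [set e] by case: gl.
rewrite setIUr cardsU BA BG cB1 (mrankE B2S) eX (cardsD1 e B2).
suff -> : (B1 :&: X :\ e) :&: (B2 :\ e) = set0.
  by rewrite cards0; case: (e \in B1) eB => /= eB; rewrite ?(negbTE eB) ?eB; clear; lia.
apply/setP=> z; rewrite !inE; apply/negP=> /andP[/andP[ze /andP[z1 _]] /andP[_ z2]].
have /setP/(_ z) := gI.
by rewrite !inE (subsetP (baseS B1S) _ z1) (subsetP (baseS B2S) _ z2) (negbTE ze).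
Qed.

Lemma glued_card S1 S2 e S B : glued S1 S2 e S -> B \in bases S ->
  let A := ground S1 :\ e in let G := ground S2 :\ e in
  (#|B :&: A| == mrank S1) = (e \notin part A e (mrank S1) B) /\
  (#|B :&: A| = mrank S1 /\ #|B :&: G|.+1 = mrank S2 \/
   #|B :&: A|.+1 = mrank S1 /\ #|B :&: G| = mrank S2).
Proof.
move=> gl BS A G; split.
  by rewrite /part; case: ifP => _; rewrite !inE eqxx // andbF.
have [_ _ bS _ _] := gl; move: BS; rewrite bS => /glueP[B1 [B2 [B1S B2S eB ->]]].
rewrite (glued_partl gl B1S B2S) setUC (glued_partl (gluedC gl) B2S B1S).
rewrite (mrankE B1S) (mrankE B2S) (cardsD1 e B1) (cardsD1 e B2).
by case: (e \in B1) eB => /= eB; rewrite ?(negbTE eB) ?eB; [right|left].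
Qed.

(** By [card_lift_thin], passing from [X] to [lift_thin S1 S2 e X] shifts all intersection sizes by
    the same amount, so the lifted set is thin in [S] and the comparison of ranks comes back to
    [X]. *)
Lemma thin_le_glued S1 S2 e S M : glued S1 S2 e S -> thin_le M S ->
  exists M1, thin_le M1 S1 /\
    bases M1 = [set part (ground S1 :\ e) e (mrank S1) B | B in bases M].
Proof.
move=> gl [gM sM thinM]; have [gI gS bS _ [[C eC CS2] [C' eC' C'S2]]] := gl.
set A := ground S1 :\ e; set r := mrank S1.
have [||M1 [gM1 bM1]] := @part_exists _ M A e r; first by rewrite !inE eqxx.
  move=> B /(subsetP sM) BS; have [_] := glued_card gl BS.
  by rewrite -/A -/r; case=> -[<- _]; rewrite leqnn leqnSn.
have partS B : B \in bases S -> part A e r B \in bases S1.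
  rewrite bS => /glueP[B1 [B2 [B1S B2S eB ->]]].
  by rewrite (part_glued gl B1S B2S).
have e1 : e \in ground S1 by have /setP/(_ e) := gI; rewrite !inE eqxx => /andP[].
exists M1; split=> //; split.
- rewrite gM1 gM gS; apply/setP=> z; rewrite !inE.
  by have [->|_ /=] := eqVneq z e; last by case: (z \in ground S1); rewrite ?andbF.
- by rewrite bM1; apply/subsetP=> _ /imsetP[B /(subsetP sM)/partS BS ->].
move=> X thinX; pose X' := lift_thin S1 S2 e X.
have cX' B : B \in bases S ->
    #|B :&: X'| + (e \in X) = #|part A e r B :&: X| + (e \in X) * mrank S2.
  rewrite bS => /glueP[B1 [B2 [B1S B2S eB ->]]].
  by rewrite (card_lift_thin _ gl B1S B2S eB) (part_glued gl B1S B2S).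
have thinX' : thin S X'.
  move=> B B' BS B'S; have := cX' _ BS; have := cX' _ B'S.
  by have := thinX _ _ (partS _ BS) (partS _ B'S); clear; lia.
have [B1 B1S <-] := rk_attained S1 X.
(* [B1] is completed by a base of [S2] that avoids or contains [e], whichever [glue] asks for. *)
have [B BS defB1] : exists2 B, B \in bases S & part A e r B = B1.
  have [eB|eB] := boolP (e \in B1).
    exists ((B1 :|: C') :\ e); last exact: part_glued gl _ _.
    by rewrite bS; apply/glueP; exists B1, C'; rewrite eB (negbTE C'S2).
  exists ((B1 :|: C) :\ e); last exact: part_glued gl _ _.
  by rewrite bS; apply/glueP; exists B1, C; rewrite CS2 (negbTE eB).
have [B' B'M rkB'] := rk_attained M X'.
have := leq_trans (rk_base X' BS) (thinM _ thinX'); rewrite -rkB'.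
have B'S := subsetP sM _ B'M.
have := cX' _ BS; have := cX' _ B'S; rewrite defB1.
have : part A e r B' \in bases M1 by rewrite bM1; apply: imset_f.
by move/(rk_base X); clear; lia.
Qed.

Lemma has_joins_glued S1 S2 e S :
  glued S1 S2 e S -> has_joins S1 -> has_joins S2 -> has_joins S.
Proof.
move=> gl J1 J2 M N MS NS; have gl' := gluedC gl.
have [gI gS bS _ _] := gl.
have [M1 [MS1 bM1]] := thin_le_glued gl MS.
have [M2 [MS2 bM2]] := thin_le_glued gl' MS.
have [N1 [NS1 bN1]] := thin_le_glued gl NS.
have [N2 [NS2 bN2]] := thin_le_glued gl' NS.
set p1 := part (ground S1 :\ e) e (mrank S1) in bM1 bN1.
set p2 := part (ground S2 :\ e) e (mrank S2) in bM2 bN2.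
have p12 B : B \in bases S -> (e \in p1 B) (+) (e \in p2 B) /\ B = (p1 B :|: p2 B) :\ e.
  rewrite bS => /glueP[B1 [B2 [B1S B2S eB ->]]].
  rewrite /p1 (part_glued gl B1S B2S) setUC /p2 (part_glued gl' B2S B1S).
  by rewrite setUC.
have [Z1 [gZ1 sZ1 MZ1 NZ1 leZ1]] := J1 _ _ MS1 NS1.
have [Z2 [gZ2 sZ2 MZ2 NZ2 leZ2]] := J2 _ _ MS2 NS2.
have inZ L L1 L2 : thin_le L S -> bases L1 = p1 @: bases L ->
    bases L2 = p2 @: bases L ->
    bases L1 \subset bases Z1 -> bases L2 \subset bases Z2 ->
    bases L \subset glue Z1 Z2 e.
  move=> [_ sL _] bL1 bL2 LZ1 LZ2; apply/subsetP=> B BL.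
  have [eB defB] := p12 _ (subsetP sL _ BL).
  apply/glueP; exists (p1 B), (p2 B); split=> //.
    by apply: (subsetP LZ1); rewrite bL1; apply: imset_f.
  by apply: (subsetP LZ2); rewrite bL2; apply: imset_f.
have MZ := inZ _ _ _ MS bM1 bM2 MZ1 MZ2.
have NZ := inZ _ _ _ NS bN1 bN2 NZ1 NZ2.
have [||Z [gZ bZ]] := @glue_exists _ Z1 Z2 e; first by rewrite gZ1 gZ2.
  have /set0Pn[B BM] := bases_neq0 M.
  by apply/set0Pn; exists B; apply: (subsetP MZ).
exists Z; rewrite bZ; split=> //; first by rewrite gZ gZ1 gZ2.
  rewrite bS; apply/subsetP=> _ /glueP[B1 [B2 [B1Z B2Z eB ->]]].
  by apply/glueP; exists B1, B2; rewrite (subsetP sZ1) ?(subsetP sZ2).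
move=> W WS MW NW; have [gW sW _] := WS.
have [W1 [WS1 bW1]] := thin_le_glued gl WS.
have [W2 [WS2 bW2]] := thin_le_glued gl' WS.
have ZW1 : bases Z1 \subset bases W1.
  by apply: leZ1 => //; rewrite bW1 ?bM1 ?bN1; apply: imsetS.
have ZW2 : bases Z2 \subset bases W2.
  by apply: leZ2 => //; rewrite bW2 ?bM2 ?bN2; apply: imsetS.
apply/subsetP=> _ /glueP[B1 [B2 [/(subsetP ZW1) + /(subsetP ZW2) + + ->]]].
rewrite bW1 bW2 => /imsetP[B BW ->] /imsetP[B' B'W ->].
rewrite -/p1 -/p2; set A := ground S1 :\ e; set G := ground S2 :\ e.
have BS := subsetP sW _ BW; have B'S := subsetP sW _ B'W.
have cW K : K \in bases W -> _ := fun KW => glued_card gl (subsetP sW _ KW).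
rewrite /= in cW.
have [pB cB] := cW _ BW; have [_ cB'] := cW _ B'W.
have [pB' _] := glued_card gl' B'S; rewrite /= in pB'.
rewrite -/A -/G -/p1 -/p2 in pB cB cB' pB' => eBB'.
(* The basepoint lies in exactly one of [p1 B] and [p2 B'], so [B] and [B'] are short on the same
   side. *)
have eqA : #|B :&: A| = #|B' :&: A|.
  move: eBB'; rewrite -[e \in p1 B]negbK -[e \in p2 B']negbK -pB -pB'.
  by move: cB cB'; clear; case: eqP; case: eqP => //=; lia.
have defB K : K \in bases S -> (K :&: ~: A = K :&: G) /\ (K :&: ~: G = K :&: A).
  move=> /baseS sK; split; apply/setP=> z; rewrite !inE; case zK: (z \in K) => //=;
    have := subsetP sK _ zK; have /setP/(_ z) := gI; rewrite gS !inE;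
    by case: eqP => //= _; case: (z \in ground S1); case: (z \in ground S2).
have -> : (p1 B :|: p2 B') :\ e = (B :&: A) :|: (B' :&: G).
  have rm_e r X K : (part (X :\ e) e r K) :\ e = K :&: (X :\ e).
    rewrite /part; case: ifP => _; apply/setP=> z; rewrite !inE;
      by have [->|] := eqVneq z e; rewrite ?andbF.
  by rewrite setDUl !rm_e.
have cM K : K \in bases W ->
    #|K :&: A| + #|K :&: G| = #|B :&: A| + #|B :&: G|.
  by move=> /cW[_]; rewrite -/A -/G; move: cB; clear; lia.
(* If [B] is full on [A], the halves splice along [A]. Otherwise [B] and [B'] are both full on [G]
   and splice along [G]. *)
case: cB => -[cBA cBG].
  rewrite -(proj1 (defB _ B'S)); apply: splice => // K /cW[_].
  by rewrite -/A -/G cBA; clear; lia.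
have cB'W := cM _ B'W.
rewrite setUC -(proj2 (defB _ BS)); apply: splice => //.
  by move: eqA cB'W; clear; lia.
move=> K KW; have := cM _ KW; have [_] := cW _ KW.
by rewrite -/A -/G; move: eqA cB'W cBA; clear; lia.
Qed.

Lemma has_joins_decomposes (Coll : ordered_matroid T -> Prop) S :
  (forall Q : ordered_matroid T, Coll Q -> mrank Q <= 2 \/ mcorank Q <= 2) ->
  decomposes_into Coll S -> has_joins S.
Proof.
move=> small; elim=> [Q /small|S1 S2 S' _ J1 _ J2 dS|S1 S2 S' _ J1 _ J2].
- exact: has_joins_small.
- exact: has_joins_direct_sum dS J1 J2.
by case/is_two_sum_glued=> e gl; apply: has_joins_glued gl J1 J2.
Qed.

End TwoSumJoins.

(** * Cyclic intervals and gaps *)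

Section CyclicOrder.

Variables (T : finType) (s : seq T).
Hypothesis s_uniq : uniq s.
Implicit Types (A B C D I J X Y : {set T}) (a b w x y z : T).

Local Notation E := [set x in s].
Local Notation pos x := (index x s).

Definition between a b y : bool :=
  (pos a < pos y < pos b) || (pos b < pos y < pos a).

(** On the circle, the chords joining [a] to [b] and [y] to [z] cross. *)
Definition crossing a b y z : bool :=
  [&& y \notin [set a; b], z \notin [set a; b] & between a b y (+) between a b z].

Lemma crossingC a b y z : crossing a b y z = crossing a b z y.
Proof. by rewrite /crossing andbCA addbC. Qed.

Definition cyclic_arc X : Prop := exists k m, X = [set x in take m (rot k s)].

Lemma pos_inj x y : x \in E -> pos x = pos y -> x = y.
Proof.
rewrite inE => xs eqn; have ys : y \in s by rewrite -index_mem -eqn index_mem.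
by rewrite -(nth_index x xs) eqn nth_index.
Qed.

Lemma mem_drop_uniq x i : x \in s -> (x \in drop i s) = (i <= pos x).
Proof.
move=> xs; rewrite leqNgt -in_take //; have := s_uniq; rewrite -{1}(cat_take_drop i s).
rewrite cat_uniq => /and3P[_ /hasPn dis _].
have := xs; rewrite -{1}(cat_take_drop i s) mem_cat.
by have [/dis/negbTE /= ->|] := boolP (x \in drop i s); case: (x \in take i s).
Qed.

Lemma interval_arc i j : i <= j <= size s ->
  cyclic_arc [set x in s | i <= pos x < j].
Proof.
move=> /andP[le_ij le_js]; exists i, (j - i); apply/setP=> x; rewrite !inE.
rewrite /rot takel_cat ?size_drop ?leq_sub2r //.
have [xs|xs] /= := boolP (x \in s); last first.
  by apply/esym/negP=> /mem_take/mem_drop; rewrite (negbTE xs).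
have [le_ix|lt_xi] := leqP i (pos x); last first.
  by apply/esym/negP=> /mem_take; rewrite mem_drop_uniq // leqNgt lt_xi.
have xd : x \in drop i s by rewrite mem_drop_uniq.
rewrite in_take // ltn_subRL; congr (_ < _).
rewrite -{1}(cat_take_drop i s) index_cat ifN ?size_takel ?(leq_trans le_ij) //.
by rewrite in_take // -leqNgt.
Qed.

Lemma interval_arcC i j : i <= j <= size s ->
  cyclic_arc [set x in s | ~~ (i <= pos x < j)].
Proof.
move=> /andP[le_ij le_js]; exists j, (size s - j + i); apply/setP=> x.
rewrite [RHS]inE /rot takeD -size_drop take_size_cat // drop_size_cat //.
rewrite -take_min (minn_idPl le_ij).
rewrite mem_cat !inE negb_and -!leqNgt -!ltnNge.
have [xs|xs] /= := boolP (x \in s); last first.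
  by apply/esym/negP=> /orP[/mem_drop|/mem_take]; rewrite (negbTE xs).
by rewrite mem_drop_uniq // in_take // orbC.
Qed.

Lemma convex_interval X : X \subset E ->
  (forall x y z, x \in X -> z \in X -> y \in E -> pos x <= pos y <= pos z -> y \in X) ->
  exists i j, i <= j <= size s /\ X = [set x in s | i <= pos x < j].
Proof.
move=> sX convX; have [->|[x0 x0X]] := set_0Vmem X.
  by exists 0, 0; split=> //; apply/setP=> x; rewrite !inE ltn0 !andbF.
have [a aX min_a] := arg_minnP (fun x => pos x) x0X.
have [b bX max_b] := arg_maxnP (fun x => pos x) x0X.
exists (pos a), (pos b).+1; split.
  rewrite index_mem -[b \in s]in_set (subsetP sX) // andbT.
  by apply: leqW; apply: min_a.
apply/setP=> x; apply/idP/idP=> [xX|].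
  rewrite inE; have := subsetP sX _ xX; rewrite inE => -> /=.
  by rewrite min_a //= ltnS; apply: max_b.
rewrite inE ltnS => /andP[xs leabx]; apply: (convX a x b) => //.
by rewrite inE.
Qed.

Lemma convex_arc X : X \subset E ->
  (forall x y z, x \in X -> z \in X -> y \in E -> pos x <= pos y <= pos z -> y \in X) ->
  cyclic_arc X /\ cyclic_arc (E :\: X).
Proof.
move=> sX /(convex_interval sX)[i [j [le_ij ->]]].
split; first exact: interval_arc.
suff -> : E :\: [set x in s | i <= pos x < j] = [set x in s | ~~ (i <= pos x < j)].
  exact: interval_arcC.
by apply/setP=> x; rewrite !inE; case: (x \in s); rewrite ?andbF ?andbT.
Qed.

(* The points of [E :\: C] with a given [gap_index] form one of the gaps into
   which [C] cuts the cycle: the modulus merges the two ends of [s]. *)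
Definition below C w : nat := #|[set c in C | pos c < pos w]|.
Definition gap_index C w : nat := below C w %% #|C|.
Definition gap C i : {set T} := [set w in E :\: C | gap_index C w == i].

Lemma below_le_card C w : below C w <= #|C|.
Proof. by apply/subset_leq_card/subsetP=> c; rewrite inE => /andP[]. Qed.

Lemma below_mono C w w' : pos w <= pos w' -> below C w <= below C w'.
Proof.
move=> le_w; apply/subset_leq_card/subsetP=> c; rewrite !inE => /andP[-> /= lt_c].
exact: leq_trans le_w.
Qed.

Lemma below_ltn C c w w' : c \in C -> pos w <= pos c < pos w' -> below C w < below C w'.
Proof.
move=> cC /andP[le_wc lt_cw']; apply: proper_card; apply/properP; split.
  apply/subsetP=> d; rewrite !inE => /andP[-> /= lt_d].
  by apply: leq_ltn_trans lt_cw'; apply: ltnW; apply: leq_trans le_wc.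
by exists c; rewrite inE cC // -leqNgt.
Qed.

Lemma below_gt0 C c w : c \in C -> pos c < pos w -> 0 < below C w.
Proof. by move=> cC lt_cw; apply/card_gt0P; exists c; rewrite inE cC. Qed.

Lemma below_lt_card C c w : c \in C -> pos w <= pos c -> below C w < #|C|.
Proof.
move=> cC le_wc; apply: proper_card; apply/properP; split.
  by apply/subsetP=> d; rewrite inE => /andP[].
by exists c; rewrite // inE negb_and -leqNgt le_wc orbT.
Qed.

(** Points in different gaps are separated by [C] on both arcs between them, and one separating
    element from each arc gives the crossing chord. *)
Lemma gap_crossing C y w : C \subset E -> y \in E :\: C -> w \in E :\: C ->
  gap_index C y != gap_index C w ->
  exists a b, [/\ a \in C, b \in C & crossing a b y w].
Proof.
move=> sC; wlog lt_yw : y w / pos y < pos w => [wlog_lt yE wE neq_g|].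
  have [lt_yw|lt_wy|eq_yw] := ltngtP (pos y) (pos w).
  - exact: wlog_lt.
  - have [||||a [b [aC bC crab]]] := wlog_lt w y => //; first by rewrite eq_sym.
    by exists a, b; rewrite crossingC.
  - by move: yE neq_g; rewrite in_setD => /andP[_ yE]; rewrite (pos_inj yE eq_yw) eqxx.
move=> yEC wEC neq_g.
move: (yEC) (wEC); rewrite !in_setD => /andP[yC yE] /andP[wC wE].
have neq_pos c v : c \in C -> v \in E -> v \notin C -> pos c != pos v.
  by move=> cC vE vC; apply: contraNneq vC => /esym/(pos_inj vE)->.
have neqC c v : c \in C -> v \notin C -> v != c by move=> cC; apply: contraNneq => ->.
have [a aC /andP[lt_ya lt_aw]] : exists2 a, a \in C & pos y < pos a < pos w.
  apply/exists_inP; apply: contraR neq_g => /exists_inPn noC.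
  suff eqb : below C w = below C y by rewrite /gap_index eqb.
  apply: eq_card => c; rewrite !inE; case cC: (c \in C) => //=.
  by have := noC _ cC; have := neq_pos _ _ cC yE yC; move: lt_yw; clear; lia.
(* Were all of [C] between [y] and [w], the counts would be 0 and [#|C|], which the modulus
   identifies. *)
have [b bC outb] : exists2 b, b \in C & (pos b < pos y) || (pos w < pos b).
  apply/exists_inP; apply: contraR neq_g => /exists_inPn inC.
  have b0 : below C y = 0.
    apply/eqP; rewrite cards_eq0; apply/eqP/setP=> c; rewrite !inE.
    by case cC: (c \in C) => //=; have := inC _ cC; clear; lia.
  have bw : below C w = #|C|.
    apply: eq_card => c; rewrite !inE; case cC: (c \in C) => //=.
    by have := inC _ cC; have := neq_pos _ _ cC wE wC; clear; lia.
  by rewrite /gap_index b0 bw modnn mod0n.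
exists a, b; split=> //; rewrite /crossing !inE !negb_or !neqC //=.
by rewrite /between; move: lt_yw lt_ya lt_aw outb; clear; lia.
Qed.

Lemma arc_gapC C i : C \subset E -> cyclic_arc (E :\: gap C i).
Proof.
move=> sC; have sgap : gap C i \subset E.
  by apply/subsetP=> w; rewrite !inE => /andP[/andP[]].
have neq_pos c v : c \in C -> v \in E -> v \notin C -> pos c != pos v.
  by move=> cC vE vC; apply: contraNneq vC => /esym/(pos_inj vE)->.
(* Index 0 collects what lies before all or after all of [C], so there the complement of the gap is
   convex in [s]; any other gap is itself convex. *)
have [i0|i_gt0] := posnP i.
  suff [] : cyclic_arc (E :\: gap C i) /\ cyclic_arc (E :\: (E :\: gap C i)) by [].
  apply: convex_arc; first exact: subsetDl.
  have inY w : w \in E -> w \notin C -> (w \in E :\: gap C i) = (0 < below C w < #|C|).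
    move=> wE wC; rewrite in_setD wE andbT inE in_setD wC wE /= i0 /gap_index.
    have := below_le_card C w; rewrite leq_eqVlt => /orP[/eqP->|lt_w].
      by rewrite modnn ltnn andbF.
    by rewrite modn_small // lt_w andbT lt0n.
  move=> x y z xY zY yE /andP[le_xy le_yz].
  have [yC|yC] := boolP (y \in C).
    by rewrite in_setD yE andbT inE in_setD yC.
  have [xE zE] : x \in E /\ z \in E by split; [case/setDP: xY|case/setDP: zY].
  rewrite inY //; apply/andP; split.
    have [xC|xC] := boolP (x \in C).
      by apply: (below_gt0 xC); rewrite ltn_neqAle neq_pos.
    by move: xY; rewrite inY // => /andP[+ _] => /leq_trans; apply; apply: below_mono.
  have [zC|zC] := boolP (z \in C); first exact: below_lt_card zC le_yz.
  by move: zY; rewrite inY // => /andP[_]; apply: leq_ltn_trans; apply: below_mono.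
suff [] : cyclic_arc (gap C i) /\ cyclic_arc (E :\: gap C i) by [].
have inG w : (w \in gap C i) = [&& w \in E :\: C, below C w == i & i < #|C|].
  rewrite inE /gap_index; congr (_ && _).
  have := below_le_card C w; rewrite leq_eqVlt => /orP[/eqP->|lt_w].
    by rewrite modnn eq_sym (gtn_eqF i_gt0); case: ltngtP.
  by rewrite modn_small //; case: eqP => // <-; rewrite lt_w.
apply: convex_arc => // x y z; rewrite !inG => /and3P[_ /eqP bx lt_i] /and3P[zEC /eqP bz _].
move=> yE /andP[le_xy le_yz]; move: (zEC); rewrite in_setD => /andP[zC zE].
rewrite in_setD yE lt_i andbT; apply/andP; split.
  apply/negP=> yC; have /below_ltn-/(_ x z) := yC.
  by rewrite bx bz le_xy ltn_neqAle neq_pos // le_yz ltnn => /(_ isT).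
by rewrite eqn_leq -{1}bz -bx !below_mono.
Qed.

Lemma mem_gap C w : w \in E :\: C -> w \in gap C (gap_index C w).
Proof. by move=> wEC; rewrite inE wEC eqxx. Qed.

(** For nonempty [C] the indices stay below [#|C|]; the bound [#|C|.+1] also admits the single index
    0 of an empty [C]. *)
Lemma sum_gaps C X : X \subset E ->
  #|X :\: C| = \sum_(i < #|C|.+1) #|X :&: gap C i|.
Proof.
move=> sX; have lt_g w : gap_index C w < #|C|.+1.
  have [C0|C_gt0] := posnP #|C|; last by rewrite ltnS ltnW // ltn_mod.
  by rewrite ltnS; apply: leq_trans (leq_mod _ _) (below_le_card _ _).
rewrite -sum1_card (partition_big (fun w => Ordinal (lt_g w)) xpredT) //=.
apply: eq_bigr => i _; rewrite -[RHS]sum1_card; apply: eq_bigl => w.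
rewrite !inE -val_eqE /=; case wX: (w \in X); last by rewrite !andbF.
by have := subsetP sX _ wX; rewrite inE => ->; rewrite !andbT.
Qed.

End CyclicOrder.

(** * Consequences of crossing exchange *)

Section CrossingExchange.

Variables (T : finType) (s : seq T).
Hypothesis s_uniq : uniq s.
Implicit Types (M P : matroid T) (A B C D I J X Y : {set T}) (a b w x y z : T).

Local Notation E := [set x in s].

(** The trace on bases of the 3-term relation in which the minors of the crossing pairs, multiplied,
    are the sum of two products of equal sign; one nonzero summand suffices. *)
Definition crossing_exchange P : Prop := forall X a b y z,
  [disjoint [set a; b; y; z] & X] -> crossing s a b y z ->
  a |: (y |: X) \in bases P -> b |: (z |: X) \in bases P ->
  a |: (b |: X) \in bases P /\ y |: (z |: X) \in bases P.

Variables M P : matroid T.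
Hypotheses (gM : ground M = E) (gP : ground P = E).
Hypothesis P_exch : crossing_exchange P.
Hypothesis arc_rk : forall I, cyclic_arc s I -> rk M I = rk P I.

Lemma setU1_setD1C X x y : x != y -> (x |: X) :\ y = x |: X :\ y.
Proof.
move=> xy; apply/setP=> z; rewrite !inE.
by have [->|] := eqVneq z x; rewrite ?xy.
Qed.

Lemma card_base_arc B D : B \in bases M -> D \in bases P -> #|B| = #|D|.
Proof.
move=> BM DP; rewrite -(rk_ground BM) -(rk_ground DP) gM gP; apply: arc_rk.
(* The whole ground set is an arc, as the complement of an empty gap of [E]. *)
suff -> : E = E :\: gap s E 0 by apply: arc_gapC.
by apply/setP=> x; rewrite !inE; case: (x \in s).
Qed.

(* Otherwise a circuit [C] of [P] lies in a base [B] of [M].  Since [P / C] splits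
   along the gaps of [C], the complement of some gap has too small a rank in [P]. *)
Lemma arc_rk_weak : bases M \subset bases P.
Proof.
apply/subsetP=> B BM; apply: contraT => BP.
have sBE : B \subset E by rewrite -gM baseS.
have /set0Pn[D0 D0P] := bases_neq0 P.
have [||C CP sCB] := @dependentP _ P B; first by rewrite gP.
  by apply: contra BP => indB; apply: (indep_baseP D0P indB); rewrite (card_base_arc BM D0P).
have sCE : C \subset E by apply: subset_trans sBE.
have [c cC] : exists c, c \in C.
  apply/set0Pn; apply: contraNneq (circuit_dep CP) => ->.
  by apply: indepS (sub0set D0) (base_indep D0P).
have /indepP[D DP sCD] := circuit_indepD1 CP cC.
have sDE : D \subset E by rewrite -gP baseS.
have cD : c \notin D.
  apply: contra (circuit_dep CP) => cD; apply: indepS (base_indep DP).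
  by rewrite -(setD1K cC) subUset sub1set cD.
(* The complement of the gap is an arc, so [B] has at most as many elements there as its rank in
   [P]. It remains to see that [D] attains this rank. *)
have le_gap i : #|D :&: gap s C i| <= #|B :&: gap s C i|.
  set g := gap s C i.
  have sgC : g \subset E :\: C by apply/subsetP=> w; rewrite inE => /andP[].
  suff rkP : rk P (D :\: g :|: E :\: g) = rk P (D :\: g).
    have := rk_base (E :\: g) BM; rewrite (arc_rk (arc_gapC s_uniq i sCE)) -/g.
    have := rk_mono P (subsetUr (D :\: g) (E :\: g)); rewrite rkP.
    have -> : B :&: (E :\: g) = B :\: g by rewrite setIDA (setIidPl sBE).
    have := rk_le_card P (D :\: g); have := cardsID g D; have := cardsID g B.
    by have := card_base_arc BM DP; clear; lia.
  apply: rk_closure => t tEg; apply/eqP; apply: contraT => rk_t.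
  have tg : t \notin g by case/setDP: tEg.
  have tE : t \in E by case/setDP: tEg.
  have rkDg : rk P (D :\: g) = #|D :\: g|.
    by apply/rk_indep/(indepS (subsetDl D g))/base_indep.
  have tDg : t \notin D :\: g.
    by apply: contra rk_t => tDg; rewrite (setUidPr _) // sub1set.
  have tD : t \notin D by apply: contra tDg => tD; rewrite inE tg.
  have indt : indep P (t |: D :\: g).
    apply: indep_rk; have := rk_le_card P (t |: D :\: g).
    have := rk_mono P (subsetU1 t (D :\: g)); move: rk_t.
    by rewrite cardsU1 tDg rkDg; clear; lia.
  have sCg : C :\ c \subset D :\: g.
    apply/subsetP=> z zC; rewrite inE (subsetP sCD) // andbT.
    apply/negP=> /(subsetP sgC); rewrite inE => /andP[/negP[]].
    by case/setD1P: zC.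
  have tC : t \notin C.
    apply/negP=> tC; have tc : t = c.
      by apply/eqP; apply: contraNT tD => tc; apply: (subsetP sCD); rewrite !inE tc.
    case/negP: (circuit_dep CP); apply: indepS indt.
    by rewrite -(setD1K cC) tc setUS.
  have [N NP [stN sND]] := indep_extend indt DP.
  have tN : t \in N by rewrite (subsetP stN) // setU11.
  (* A [t] outside the span of [D :\: g] enters [D] at the expense of some [y] in [g], so [t] and
     [y] lie in different gaps of [C]. *)
  have [y yD yN] : exists2 y, y \in D & y \notin N.
    apply/subsetPn; apply: contraL (leqnn #|N|) => sDN; rewrite -ltnNge.
    rewrite (card_base NP DP); have := subset_leq_card (_ : t |: D \subset N).
    rewrite cardsU1 tD (card_base NP DP) add1n ltnn => -> //.
    by rewrite subUset sub1set tN.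
  have yg : y \in g.
    by apply: contraNT yN => yg; apply: (subsetP stN); rewrite in_setU1 in_setD yg yD orbT.
  have defN : N = t |: D :\ y.
    apply/eqP; rewrite eqEcard card_swap // (card_base NP DP) leqnn andbT.
    apply/subsetP=> z zN; rewrite !inE; have [//|zt /=] := eqVneq z t.
    have zy : z != y by apply: contraNneq yN => <-.
    by have := subsetP sND _ zN; rewrite !inE (negbTE zt) zy /= => /orP[/andP[]|].
  have yC : y \notin C by have := subsetP sgC _ yg; case/setDP.
  have yE : y \in E by apply: (subsetP sDE).
  have [|||a [b [aC bC crab]]] := @gap_crossing _ s C y t sCE.
  - by rewrite in_setD yC.
  - by rewrite in_setD tC.
  - apply: contra tg => /eqP eq_g; move: yg; rewrite /g !inE eq_g => /andP[_ ->].
    by move: tE; rewrite inE => ->; rewrite tC.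
  case/and3P: (crab); rewrite !inE !negb_or => /andP[ya yb] /andP[ta tb] btw.
  have ab : a != b.
    by apply: contraTneq btw => ->; rewrite /between; clear; lia.
  (* Adding [a], [y] to [X] gives [(c |: D) :\ b], and adding [b], [t] gives [(c |: N) :\ a]: both
     are bases by [circuit_swap]. Adding [a], [b] gives a set containing the circuit [C], which
     crossing exchange would make a base. *)
  pose X := (c |: D) :\ a :\ b :\ y.
  have cDy : c != y by apply: contraNneq yC => <-.
  have cD_sub d : d \in C -> d \in c |: D.
    move=> dC; rewrite !inE; have [//|dc] := eqVneq d c.
    by rewrite (subsetP sCD) // !inE dc.
  have eX1 : a |: (y |: X) = (c |: D) :\ b.
    apply/setP=> z; rewrite !inE.
    have [->|za] := eqVneq z a; first by rewrite ab -in_setU1 cD_sub.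
    have [->|zy] := eqVneq z y; first by rewrite /= yb yD orbT.
    by [].
  have eX2 : b |: (t |: X) = (c |: N) :\ a.
    apply/setP=> z; rewrite defN !inE.
    have [->|zb] := eqVneq z b.
      rewrite [b == a]eq_sym (negbTE ab) /=; have := cD_sub _ bC; rewrite !inE => /orP[->//|->].
      by rewrite [b == y]eq_sym yb !orbT.
    have [->|zt] := eqVneq z t; first by rewrite ta /= !orbT.
    have [->|zy] := eqVneq z y; last by [].
    by rewrite [y == c]eq_sym (negbTE cDy) andbF.
  have [|||XP _] := @P_exch X a b y t _ crab.
  - apply/pred0P=> z /=; rewrite !inE.
    case: (z == y); case: (z == b); case: (z == a) => //=; case: eqP => //= ->.
    by rewrite (negbTE tD) orbF; apply: contraNF tC => /eqP->.
  - by rewrite eX1; apply: circuit_swap CP DP cC sCD bC.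
  - rewrite eX2; apply: circuit_swap CP NP cC _ aC.
    by apply: subset_trans sCg (subset_trans (subsetUr _ _) stN).
  case/negP: (circuit_dep CP); apply: indepS (base_indep XP).
  apply/subsetP=> z zC; rewrite !inE; have [//|za] := eqVneq z a.
  have [//|zb /=] := eqVneq z b.
  rewrite -[(z == c) || _]in_setU1 cD_sub // andbT.
  by apply: contraNneq yC => <-.
(* Summed over the gaps, [D] has no more elements than [B] outside [C]. Inside [C] it has strictly
   fewer, as it misses [c], although both have the same size. *)
have := sum_gaps C sBE; have := sum_gaps C sDE => sumD sumB.
have : #|D :\: C| <= #|B :\: C| by rewrite sumD sumB; apply: leq_sum.
have := cardsID C D; have := cardsID C B; rewrite (setIidPr sCB).
have : #|D :&: C| < #|C|.
  apply: proper_card; apply/properP; split; first exact: subsetIr.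
  by exists c; rewrite // inE (negbTE cD).
by have := card_base_arc BM DP; clear; lia.
Qed.

(** On a chain of exchanges from [B] towards [B'], this is the first step that replaces an element
    of [A] by one outside [A]. *)
Lemma adjacent_bases A B B' : B \in bases P -> B' \in bases P ->
  #|B' :&: A| < #|B :&: A| ->
  exists B0 x y, [/\ B0 \in bases P, y |: B0 :\ x \in bases P,
    #|B0 :&: A| = #|B :&: A|, x \in B0 :&: A & y \notin A :|: B0].
Proof.
have [n] := ubnP #|B :\: B'|; elim: n B => // n IHn B lt_n BP B'P lt_A.
have [x xB xB'] : exists2 x, x \in B :&: A & x \notin B' :&: A.
  by apply/subsetPn; apply: contraL lt_A => /subset_leq_card; rewrite leqNgt.
move: (xB) xB'; rewrite !inE => /andP[xB1 xA]; rewrite xA andbT => xB'.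
have [|y] := @exchange_base _ P B B' x BP B'P; first by rewrite inE xB'.
rewrite inE => /andP[yB yB'] B1P.
have [yA|yA] := boolP (y \in A); last first.
  by exists B, x, y; split=> //; rewrite in_setU negb_or yA.
have cB1 : #|(y |: B :\ x) :&: A| = #|B :&: A|.
  have -> : (y |: B :\ x) :&: A = y |: (B :&: A) :\ x.
    apply/setP=> z; rewrite !inE.
    by have [->|_ /=] := eqVneq z y; rewrite ?yA //= andbA.
  by rewrite card_swap // inE negb_and yB.
rewrite -cB1; apply: IHn; rewrite ?cB1 //.
rewrite ltnS in lt_n; apply: leq_trans lt_n; apply: proper_card.
apply/properP; split.
  apply/subsetP=> z; rewrite !inE => /andP[zB' /orP[/eqP zy|/andP[_ ->]]].
    by rewrite zy yB' in zB'.
  by rewrite zB'.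
exists x; first by rewrite inE xB'.
by rewrite !inE eqxx xB' orbF; apply: contraNneq xB' => ->.
Qed.

(* If the rank of [A] dropped, [M] would be a direct sum of its restrictions to
   [A] and to its complement, while [P] is a 2-sum there.  [C] and [D] are a circuit of
   one part and a cocircuit of the other through the basepoint; by crossing
   exchange an arc [I] contains [C] and avoids [D], and [rk P I = rk M I] fails. *)
Lemma arc_rk_thin_le : thin_le M P.
Proof.
have sMP := arc_rk_weak; split=> //; first by rewrite gM.
move=> A thinA; rewrite leqNgt; apply/negP=> lt_rk.
have [BA BAP rkBA] := rk_attained P A.
have /set0Pn[B' B'M] := bases_neq0 M; have B'P := subsetP sMP _ B'M.
have lt_B' : #|B' :&: A| < #|BA :&: A|.
  by rewrite rkBA; apply: leq_ltn_trans lt_rk; apply: rk_base.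
have [B0 [x [y [B0P B1P cB0 xB0A yAB0]]]] := adjacent_bases BAP B'P lt_B'.
rewrite rkBA in cB0; move: xB0A yAB0; rewrite !inE negb_or => /andP[xB0 xA] /andP[yA yB0].
have minA B : B \in bases P -> rk P A <= #|B :&: A|.+1.
  by move=> BP; rewrite -rkBA; apply: thinA.
pose G := ~: A; set r := #|B0|.
have card_r B : B \in bases P -> #|B :&: A| + #|B :&: G| = r.
  by move=> BP; rewrite /r -(card_base BP B0P) -(cardsID A B) setDE.
have swapA u t : u \in A -> t \notin A -> (t |: B0 :\ u) :&: A = (B0 :&: A) :\ u.
  move=> uA tA; apply/setP=> z; rewrite !inE.
  by have [->|_ /=] := eqVneq z t; rewrite ?(negbTE tA) ?andbF //= andbA.
have card_swapA u t : u \in B0 :&: A -> t \notin A ->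
    #|(t |: B0 :\ u) :&: A|.+1 = rk P A.
  move=> uBA tA; rewrite swapA //; last by case/setIP: uBA.
  by rewrite -cB0 (cardsD1 u (B0 :&: A)) uBA.
have xBA : x \in B0 :&: A by rewrite inE xB0.
have rkMA : (rk M A).+1 = rk P A.
  by have := minA _ B'P; have := rk_base A B'M; move: lt_rk; clear; lia.
(* The connectivity of [A] in [P] is exactly 1, attained by [B0] and its neighbour
   [y |: B0 :\ x]. *)
have rkG : rk P G + rk P A = r.+1.
  have [B BP rkB] := rk_attained P G.
  have := minA _ BP; have := card_r _ BP; rewrite rkB.
  have := rk_base G B1P; have := card_r _ B1P; have := card_swapA _ _ xBA yA.
  by clear; lia.
have rkMr X : A \subset X -> G \subset X -> rk M X = r.
  move=> AX GX; have := rk_ground B'M; rewrite (card_base B'P B0P) -/r => rkE.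
  apply/eqP; rewrite eqn_leq {1}/r -(card_base B'P B0P) (rk_le_mrank _ B'M) /= -rkE.
  apply: rk_mono; apply/subsetP=> z _; case zA: (z \in A).
    exact: (subsetP AX).
  by apply: (subsetP GX); rewrite inE zA.
(* [C] is the part inside [A] of the fundamental circuit of [y] with respect to [B0], and [D] the
   part outside [A] of the fundamental cocircuit of [x]. *)
pose C := [set u in B0 :&: A | y |: B0 :\ u \in bases P].
pose D := [set t in ~: (A :|: B0) | t |: B0 :\ x \in bases P].
have CP u : u \in C -> [/\ u \in B0, u \in A & y |: B0 :\ u \in bases P].
  by rewrite !inE => /andP[/andP[]].
have DP t : t \in D -> [/\ t \notin B0, t \notin A & t |: B0 :\ x \in bases P].
  by rewrite !inE negb_or => /andP[/andP[]].
have sCBA : C \subset B0 :&: A by apply/subsetP=> u; rewrite inE => /andP[].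
(* [t |: B0 :\ x] and [y |: B0 :\ u] both have the maximal number of elements in [G], so the
   [G]-half of the first splices with the [A]-half of the second. *)
have mixed u t : u \in C -> t \in D -> t |: B0 :\ u \in bases P.
  move=> uC tD; have [uB0 uA N'P] := CP _ uC; have [tB0 tA NP] := DP _ tD.
  have uBA := subsetP sCBA _ uC.
  have := splice (A := G) NP N'P.
  have -> : (t |: B0 :\ x) :&: G :|: (y |: B0 :\ u) :&: ~: G = t |: B0 :\ u.
    rewrite setCK swapA //; apply/setP=> z; rewrite !inE.
    have [->|zt] := eqVneq z t; first by rewrite tA.
    case zA: (z \in A); rewrite ?andbF ?andbT //= ?orbF.
    have [zx|_ /=] := eqVneq z x; first by rewrite zx xA in zA.
    by have [zu|//] := eqVneq z u; rewrite zu uA in zA.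
  apply.
    have := card_r _ NP; have := card_r _ N'P.
    by have := card_swapA _ _ xBA tA; have := card_swapA _ _ uBA yA; clear; lia.
  move=> B BP; have := card_r _ BP; have := card_r _ NP; have := minA _ BP.
  by have := card_swapA _ _ xBA tA; clear; lia.
have xC : x \in C by rewrite !inE xB0 xA.
have yD : y \in D by rewrite !inE negb_or yA yB0.
have CgroundE : C \subset E.
  by apply/subsetP=> u /CP[uB0 _ _]; rewrite -gP (subsetP (baseS B0P)).
have DC t : t \in D -> t \in E :\: C.
  move=> tD; have [tB0 tA tP] := DP _ tD; rewrite in_setD -gP.
  rewrite (subsetP (baseS tP)) ?setU11 // andbT.
  by apply: contra tA => /CP[].
(* Otherwise crossing exchange on two bases from [mixed] would produce a base two short on [A],
   against the thinness of [A]. *)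
have sameD t : t \in D -> gap_index s C t = gap_index s C y.
  move=> tD; apply/eqP; apply: contraT => neq_g.
  have [u [v [uC vC cr]]] := gap_crossing CgroundE (DC _ tD) (DC _ yD) neq_g.
  have [tB0 tA _] := DP _ tD.
  have [uB0 uA _] := CP _ uC; have [vB0 vA _] := CP _ vC.
  case/and3P: (cr); rewrite !inE !negb_or => /andP[tu tv] /andP[yu yv] btw.
  have uv : u != v by apply: contraTneq btw => ->; rewrite /between; clear; lia.
  have [|||_ NP] := @P_exch (B0 :\ u :\ v) u v t y _ cr.
  - apply/pred0P=> z /=; rewrite !inE.
    case: (z == u); case: (z == v); rewrite ?andbF //=.
    by case: eqP => [->|_]; rewrite ?(negbTE tB0) //=; case: eqP => //= ->; apply/negbTE.
  - suff -> : u |: (t |: B0 :\ u :\ v) = t |: B0 :\ v by apply: mixed.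
    apply/setP=> z; rewrite !inE; have [->|//] := eqVneq z u.
    by rewrite uv uB0 orbT.
  - suff -> : v |: (y |: B0 :\ u :\ v) = y |: B0 :\ u by apply: mixed.
    apply/setP=> z; rewrite !inE; have [->|//] := eqVneq z v.
    by rewrite [v == u]eq_sym uv vB0 orbT.
  have := minA _ NP; have -> : (t |: (y |: B0 :\ u :\ v)) :&: A = (B0 :&: A) :\ u :\ v.
    apply/setP=> z; rewrite !inE.
    have [->|_] := eqVneq z t; first by rewrite (negbTE tA) ?andbF.
    by have [->|_] := eqVneq z y; rewrite ?(negbTE yA) ?andbF //= !andbA.
  have := cardsD1 u (B0 :&: A); have := cardsD1 v ((B0 :&: A) :\ u).
  by rewrite !inE [v == u]eq_sym uv uB0 uA vB0 vA /= cB0; clear; lia.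
pose I := E :\: gap s C (gap_index s C y).
have arcI : cyclic_arc s I by apply: arc_gapC.
have sCI : C \subset I.
  apply/subsetP=> u uC; rewrite in_setD (subsetP CgroundE) // andbT.
  by rewrite inE in_setD uC.
have dDI t : t \in D -> t \notin I.
  by move=> tD; apply/negP=> /setDP[_ /negP[]]; rewrite -(sameD t tD); apply/mem_gap/DC.
have subm (Q : matroid T) (X Y U V : {set T}) : U \subset X :|: Y -> V \subset X :&: Y ->
    rk Q U + rk Q V <= rk Q X + rk Q Y.
  move=> sU sV; apply: leq_trans (rk_submod Q X Y).
  by rewrite leq_add ?rk_mono.
have rkC : rk P C = #|C|.
  by apply/rk_indep/(indepS _ (base_indep B0P))/(subset_trans sCBA)/subsetIl.
(* [C] and [G] are not skew: the fundamental circuit [y |: F] meets both sides. Submodularity is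
   applied to it and [G]. *)
have rkCG : (rk P (C :|: G)).+1 <= rk P C + rk P G.
  pose F := [set u in B0 | y |: B0 :\ u \in bases P].
  have sFB0 : F \subset B0 by apply/subsetP=> u; rewrite inE => /andP[].
  have yF : y \notin F by apply: contra yB0; apply: (subsetP sFB0).
  have rkF : rk P (y |: F) <= #|F|.
    have := rk_le_card P (y |: F); rewrite cardsU1 yF leq_eqVlt => /orP[/eqP rkF|//].
    have indF : indep P (y |: F) by apply: indep_rk; rewrite cardsU1 yF.
    have [N NP [sFN sN]] := indep_extend indF B0P.
    have sNB0 : N \subset y |: B0.
      apply: subset_trans sN _; rewrite -setUA subUset subsetUl /= setUC.
      by rewrite subUset subsetUr subsetU // sFB0 orbT.
    have yN : y \in N by apply: (subsetP sFN); apply: setU11.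
    have [u uB0 uN] : exists2 u, u \in B0 & u \notin N.
      apply/subsetPn; apply: contraL (leqnn #|N|) => sB0N; rewrite -ltnNge.
      have : #|y |: B0| <= #|N| by apply: subset_leq_card; rewrite subUset sub1set yN.
      by rewrite cardsU1 yB0 (card_base NP B0P) add1n.
    have defN : N = y |: B0 :\ u.
      apply/eqP; rewrite eqEcard card_swap // (card_base NP B0P) leqnn andbT.
      rewrite -setU1_setD1C ?subsetD1 ?sNB0 //.
      by apply: contraNneq yB0 => ->.
    case/negP: uN; apply: (subsetP sFN); rewrite inE; apply/orP; right.
    by rewrite inE uB0 -defN.
  have cF := cardsID A F.
  have FA : F :&: A = C.
    by apply/setP=> u; rewrite !inE; case: (u \in A); rewrite ?andbT ?andbF.
  have rkV : rk P (y |: F :\: A) = #|F :\: A|.+1.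
    rewrite (rk_indep (indepS _ (base_indep B1P))); last first.
      apply: setUS; apply/subsetP=> u /setDP[/(subsetP sFB0) uB0 uA].
      by rewrite !inE uB0 andbT; apply: contraNneq uA => ->.
    by rewrite cardsU1 inE negb_and yF orbT.
  have := subm P (y |: F) G (C :|: G) (y |: F :\: A).
  rewrite rkV rkC -FA; have sU : F :&: A :|: G \subset y |: F :|: G.
    by apply: setSU; rewrite subIset // subsetU // subxx orbT.
  have sV : y |: F :\: A \subset (y |: F) :&: G.
    apply/subsetP=> z; rewrite !inE => /orP[/eqP->|/andP[-> ->]]; last by rewrite orbT.
    by rewrite eqxx yA.
  by move=> /(_ sU sV); rewrite FA in cF *; move: cF rkF; clear; lia.
(* [G :\: D] lies in the span of [B0 :\ x], while [y] does not. *)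
have rkGD : (rk P (G :\: D)).+1 <= rk P G.
  pose K := B0 :\ x.
  have rkK : rk P K = #|K|.
    by apply/rk_indep/(indepS _ (base_indep B0P))/subD1set.
  have cK : #|K|.+1 = r by rewrite /r (cardsD1 x B0) xB0.
  have rkKGD : rk P (K :|: G :\: D) = rk P K.
    apply: rk_closure => t /setDP[]; rewrite inE => tA tD.
    apply/eqP; apply: contraNT tD => neq_rk.
    have tK : t \notin K.
      by apply: contra neq_rk => tK; rewrite (setUidPr _) // sub1set.
    have indt : indep P (t |: K).
      apply: indep_rk; have := rk_le_card P (t |: K).
      have := rk_mono P (subsetU1 t K); move: neq_rk.
      by rewrite cardsU1 tK rkK; clear; lia.
    rewrite !inE negb_or tA /=; apply/andP; split.
      apply: contra tK => tB0; rewrite !inE tB0 andbT.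
      by apply: contraNneq tA => ->.
    by apply: (indep_baseP B0P indt); rewrite cardsU1 tK add1n cK.
  have rky : r <= rk P (y |: K).
    apply: leq_trans (rk_base (y |: K) B1P).
    by rewrite setIid (card_base B1P B0P).
  have := subm P (K :|: G :\: D) G (y |: K) (G :\: D).
  rewrite rkKGD rkK => /(_ _ _) h; move: h rky cK.
  have -> : (y |: K \subset K :|: G :\: D :|: G) = true.
    rewrite subUset sub1set !inE yA !orbT /=.
    by rewrite -setUA subsetUl.
  have -> : (G :\: D \subset (K :|: G :\: D) :&: G) = true.
    by rewrite subsetI subsetUr subsetDl.
  by move=> /(_ isT isT); clear; lia.
pose U := I :&: A; pose V := I :\: A.
have defI : U :|: V = I by apply: setID.
(* By [rkGD] and [rkG], [A] and [G :\: D] are skew in [P], and so are their subsets [U] and [V]. *)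
have rkI : rk P U + rk P V <= rk P I.
  have rkAGD : r <= rk P (A :|: G :\: D).
    rewrite -[r](rk_indep (base_indep B0P)); apply: rk_mono.
    apply/subsetP=> z zB0; rewrite in_setU in_setD in_setC; case: (z \in A) => //=.
    by rewrite andbT; apply: contraL zB0 => /DP[].
  have h1 := subm P (V :|: A) (G :\: D) (A :|: G :\: D) V.
  have h2 := subm P A I (V :|: A) U.
  move: h1 h2; have -> : (A :|: G :\: D \subset V :|: A :|: G :\: D) = true.
    by rewrite -setUA subsetUr.
  have -> : (V \subset (V :|: A) :&: (G :\: D)) = true.
    rewrite subsetI subsetUl; apply/subsetP=> z /setDP[zI zA].
    by rewrite in_setD in_setC zA andbT; apply: contraL zI; apply: dDI.
  have -> : (V :|: A \subset A :|: I) = true by rewrite setUC setUS // subsetDl.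
  have -> : (U \subset A :&: I) = true by rewrite /U setIC subxx.
  move=> /(_ isT isT) h1 /(_ isT isT) h2.
  by move: h1 h2 rkAGD rkGD rkG; clear; lia.
(* In [P], [rkCG] says that [U], containing [C], spans part of [G]. In [M] the two sides are skew,
   so the rank that [U] adds to [G] is its full rank. *)
have rkU : (rk M U).+1 <= rk P U.
  have h1 := subm P U (C :|: G) (U :|: G) C.
  have h2 := subm M (U :|: G) A (U :|: G :|: A) U.
  move: h1 h2; have -> : (U :|: G \subset U :|: (C :|: G)) = true.
    by rewrite setUS // subsetUr.
  have sCU : C \subset U by rewrite subsetI sCI (subset_trans sCBA) // subsetIr.
  have -> : (C \subset U :&: (C :|: G)) = true by rewrite subsetI sCU subsetUl.
  have -> : (U \subset (U :|: G) :&: A) = true by rewrite subsetI subsetUl subsetIr.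
  rewrite subxx => /(_ isT isT) h1 /(_ isT isT).
  rewrite rkMr ?subsetUr //; last by rewrite -setUA setUCA subsetUl.
  have := rk_weak (U :|: G) sMP.
  by move: h1 rkCG rkG rkMA; clear; lia.
have rkMI : rk M I <= rk M U + rk M V.
  by rewrite -defI; apply: leq_trans (rk_submod M U V); apply: leq_addr.
have := rk_weak V sMP; move: rkI rkU rkMI; rewrite (arc_rk arcI); clear; lia.
Qed.

End CrossingExchange.

(** * Pluecker relations and signs *)

Import Order.TTheory GRing.Theory Num.Theory.

Section Pluecker.

Local Open Scope ring_scope.

Lemma det_2x2 (F : comPzRingType) (A : 'M[F]_(1 + 1)) :
  \det A = A 0 0 * A 1 1 - A 0 1 * A 1 0.
Proof.
rewrite (expand_det_row _ 0) !big_ord_recl big_ord0 addr0 /cofactor !det_mx11 !mxE.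
rewrite /= expr0 expr1 mul1r mulN1r mulrN; congr (_ * A _ _ - A _ _ * A _ _);
  exact: val_inj.
Qed.

Variable F : realFieldType.

Definition vdm r n : 'M[F]_(r, n) := Vandermonde r (\row_j (j : nat)%:R).

Lemma colsub_vdmE r n (g : 'I_r -> 'I_n) :
  \det (colsub g (vdm r n)) =
    \prod_(i < r) \prod_(j < r | (i < j)%N) ((g j)%:R - (g i)%:R).
Proof.
have -> : colsub g (vdm r n) = Vandermonde r (\row_j (g j : nat)%:R).
  by apply/matrixP=> i j; rewrite !mxE.
rewrite det_Vandermonde; apply: eq_bigr => i _; apply: eq_bigr => j _.
by rewrite !mxE.
Qed.

Lemma sort_injective r n (g : 'I_r -> 'I_n) : injective g ->
  exists p : 'S_r, {homo g \o p : i j / (i < j)%N}.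
Proof.
move=> injg; pose leI := relpre (@nat_of_ord n) leq.
pose t := [tuple g i | i < r].
have [p tE] : exists p : 'S_r, sort leI t = [tuple tnth t (p i) | i < r].
  by apply/tuple_permP; rewrite perm_sort.
exists p => i j lt_ij /=.
have srt : sorted (relpre (@nat_of_ord n) ltn) (sort leI t).
  rewrite -sorted_map ltn_sorted_uniq_leq sorted_map sort_sorted => [|x y].
    rewrite andbT map_inj_uniq; last exact: val_inj.
    by rewrite sort_uniq; apply/tuple_uniqP=> x y; rewrite !tnth_mktuple; apply: injg.
  exact: leq_total.
have gE l : g (p l) = nth (g i) (sort leI t) l.
  by rewrite tE -tnth_nth tnth_mktuple tnth_mktuple.
rewrite 2!gE; apply: (sorted_ltn_nth (leT := relpre (@nat_of_ord n) ltn)) => //.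
- by move=> x y z /=; apply: ltn_trans.
- by rewrite inE size_sort size_tuple.
- by rewrite inE size_sort size_tuple.
Qed.

(* [vdm] serves to compute signs: reordering columns changes the sign of both
   factors alike, and all its maximal minors with increasing columns are positive. *)
Lemma minor_vdm_ge0 r n (A : 'M[F]_(r, n)) (g : 'I_r -> 'I_n) :
  (forall f : 'I_r -> 'I_n, {homo f : i j / (i < j)%N} -> 0 <= \det (colsub f A)) ->
  injective g -> 0 <= \det (colsub g A) * \det (colsub g (vdm r n)).
Proof.
move=> A_ge0 /sort_injective[p mono_gp].
have detE (B : 'M[F]_(r, n)) :
    \det (colsub g B) = (-1) ^+ p * \det (colsub (g \o p) B).
  have -> : colsub (g \o p) B = col_perm p (colsub g B).
    by apply/matrixP=> i j; rewrite !mxE.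
  rewrite col_permE det_mulmx det_perm odd_permV mulrCA -signr_addb.
  by rewrite addbb mulr1.
rewrite !detE mulrACA -signr_addb addbb mul1r mulr_ge0 ?A_ge0 //.
rewrite colsub_vdmE; apply: prodr_ge0 => i _; apply: prodr_ge0 => j lt_ij.
by rewrite subr_ge0 ler_nat ltnW // mono_gp.
Qed.

Variables k n : nat.
Implicit Types (A V : 'M[F]_(k + (1 + 1), n)) (X : 'I_k -> 'I_n) (u v : 'I_n).

Definition adjoin2 X u v (i : 'I_(k + (1 + 1))) : 'I_n :=
  match split i with inl j => X j | inr j => if j == 0 then u else v end.

Definition minor2 A X u v : F := \det (colsub (adjoin2 X u v) A).

Lemma adjoin2_lshift X u v j : adjoin2 X u v (lshift _ j) = X j.
Proof. by rewrite /adjoin2 -[lshift _ _]/(unsplit (inl j)) unsplitK. Qed.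

Lemma adjoin2_rshift X u v j :
  adjoin2 X u v (rshift _ j) = if j == 0 then u else v.
Proof. by rewrite /adjoin2 -[rshift _ _]/(unsplit (inr j)) unsplitK. Qed.

Lemma adjoin2_inj X u v : injective X -> u != v ->
  (forall j, X j != u) -> (forall j, X j != v) -> injective (adjoin2 X u v).
Proof.
move=> injX uv Xu Xv i1 i2.
rewrite -[i1]splitK -[i2]splitK.
case: (split i1) => j1; case: (split i2) => j2 /=;
  rewrite ?adjoin2_lshift ?adjoin2_rshift.
- by move/injX->.
- by case: ifP => _ /eqP; rewrite ?(negbTE (Xu _)) ?(negbTE (Xv _)).
- by case: ifP => _ /esym/eqP; rewrite ?(negbTE (Xu _)) ?(negbTE (Xv _)).
case: eqP => [->|/eqP j1N0]; case: eqP => [->|/eqP j2N0] //.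
- by move/eqP; rewrite (negbTE uv).
- by move/esym/eqP; rewrite (negbTE uv).
move=> _; congr rshift; apply: val_inj => /=.
by case: j1 j1N0 => [[|[|//]] //]; case: j2 j2N0 => [[|[|//]] //].
Qed.

(* Multiplying by the inverse of the matrix on the columns [X], [s], [y] reduces
   the relation to 2x2 minors. *)
Lemma pluecker3 A X s y t z : minor2 A X s y != 0 ->
  minor2 A X s t * minor2 A X y z =
    minor2 A X s y * minor2 A X t z + minor2 A X s z * minor2 A X y t.
Proof.
set Q := colsub (adjoin2 X s y) A => Q0.
have uQ : Q \in unitmx by rewrite unitmxE unitfE.
have [A' defA] : exists A', A = Q *m A' by exists (invmx Q *m A); rewrite mulKVmx.
have colsubE g : colsub g A = Q *m colsub g A'.
  by rewrite {1}defA; apply/matrixP=> i j; rewrite !mxE; apply: eq_bigr => l _; rewrite !mxE.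
have minorE u v : minor2 A X u v = \det Q * minor2 A' X u v.
  by rewrite /minor2 -det_mulmx colsubE.
have A'X i j : A' i (X j) = (i == lshift _ j)%:R.
  have /matrixP/(_ i (lshift _ j)) : colsub (adjoin2 X s y) A' = 1%:M.
    by apply: (can_inj (mulKmx uQ)); rewrite -colsubE mulmx1.
  by rewrite !mxE adjoin2_lshift.
pose a u := A' (rshift k 0) u; pose b u := A' (rshift k 1) u.
have minor'E u v : minor2 A' X u v = a u * b v - a v * b u.
  rewrite /minor2 -[colsub _ _]submxK.
  have -> : ulsubmx (colsub (adjoin2 X u v) A') = 1%:M.
    by apply/matrixP=> i j; rewrite !mxE adjoin2_lshift A'X (inj_eq (@lshift_inj _ _)).
  have -> : dlsubmx (colsub (adjoin2 X u v) A') = 0.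
    by apply/matrixP=> i j; rewrite !mxE adjoin2_lshift A'X eq_rlshift.
  by rewrite det_ublock det1 mul1r det_2x2 !mxE !adjoin2_rshift.
by rewrite !minorE !minor'E; ring.
Qed.

(** Separates what depends on [X], on each single column, and on the order of [u] and [v]. *)
Lemma minor2_vdm X u v :
  minor2 (vdm _ _) X u v =
    (\prod_(i < k) \prod_(j < k | (i < j)%N) ((X j)%:R - (X i)%:R))
    * (\prod_(i < k) ((u%:R - (X i)%:R) * (v%:R - (X i)%:R))) * (v%:R - u%:R).
Proof.
rewrite /minor2 colsub_vdmE big_split_ord /= -big_split /=; congr (_ * _).
  apply: eq_bigr => i _; rewrite big_split_ord /=; congr (_ * _).
    by apply: eq_bigr => j _; rewrite !adjoin2_lshift.
  rewrite (eq_bigl xpredT) => [|j]; last by rewrite ltn_addr.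
  by rewrite !big_ord_recl big_ord0 mulr1 adjoin2_lshift !adjoin2_rshift.
have inner (i : 'I_(1 + 1)) : \prod_(j < k + (1 + 1) | (k + i < j)%N)
      ((adjoin2 X u v j)%:R - (adjoin2 X u v (rshift k i))%:R) =
    \prod_(j < 1 + 1 | (i < j)%N) ((adjoin2 X u v (rshift k j))%:R
      - (adjoin2 X u v (rshift k i))%:R) :> F.
  rewrite big_split_ord /= big_pred0 ?mul1r.
    by apply: eq_bigl => j; rewrite ltn_add2l.
  by move=> j; apply/negbTE; rewrite -leqNgt ltnW // ltn_addr.
rewrite (eq_bigr _ (fun i _ => inner i)) !big_ord_recl big_ord0 mulr1.
rewrite big_mkcond [X in _ * X]big_mkcond !big_ord_recl !big_ord0 /= !adjoin2_rshift /=.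
by rewrite !mulr1 mul1r.
Qed.

(* The positivity hypothesis makes the two products on the right-hand side of
   [pluecker3] have the same sign. *)
Lemma crossing_minors A X (s y t z : 'I_n) :
  (forall f : 'I_(k + (1 + 1)) -> 'I_n,
     {homo f : i j / (i < j)%N} -> 0 <= \det (colsub f A)) -> injective X ->
  (forall j, X j \notin [:: s; y; t; z]) ->
  uniq [:: s; y; t; z] ->
  0 < ((y : nat)%:R - s%:R) * (z%:R - t%:R) * ((z%:R - s%:R) * (t%:R - y%:R)) :> F ->
  minor2 A X s y != 0 -> minor2 A X t z != 0 ->
  minor2 A X s t != 0 /\ minor2 A X y z != 0.
Proof.
move=> A_ge0 injX notX; rewrite /= !inE !negb_or.
case/and4P=> /and3P[sy st sz] /andP[yt yz] tz _ pos_d sy0 tz0.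
have nX u j : u \in [:: s; y; t; z] -> X j != u.
  by move=> uin; apply: contraNneq (notX j) => ->.
have inj u v : u != v -> u \in [:: s; y; t; z] -> v \in [:: s; y; t; z] ->
    0 <= minor2 A X u v * minor2 (vdm _ _) X u v.
  move=> uv uin vin; apply: minor_vdm_ge0 => //.
  by apply: adjoin2_inj => // j; apply: nX.
have [i1 i2 i3 i4] : [/\ s \in [:: s; y; t; z], y \in [:: s; y; t; z],
  t \in [:: s; y; t; z] & z \in [:: s; y; t; z]] by rewrite !inE !eqxx !orbT.
have h1 := inj _ _ sy i1 i2; have h2 := inj _ _ tz i3 i4.
have h3 := inj _ _ sz i1 i4; have h4 := inj _ _ yt i2 i3.
(* In the product of four such minors [K] and each [p] occur to an even power, so only the sign of
   the four differences remains. *)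
pose K := (\prod_(i < k) \prod_(j < k | (i < j)%N) ((X j)%:R - (X i)%:R)) : F.
pose p (u : 'I_n) := \prod_(i < k) (u%:R - (X i)%:R) : F.
have wE u v : minor2 (vdm _ _) X u v = K * (p u * p v) * (v%:R - u%:R).
  by rewrite minor2_vdm big_split.
have subN0 (i j : 'I_n) : i != j -> (i : nat)%:R - (j : nat)%:R != 0 :> F.
  by move=> ij; rewrite subr_eq0 eqr_nat.
have K0 : K != 0.
  apply/prodf_neq0=> i _; apply/prodf_neq0=> j lt_ij; apply: subN0.
  by rewrite (inj_eq injX) neq_ltn lt_ij orbT.
have p0 u : u \in [:: s; y; t; z] -> p u != 0.
  by move=> uin; apply/prodf_neq0=> i _; apply: subN0; rewrite eq_sym nX.
have pos_p : 0 < (K * K * (p s * p y * p t * p z)) ^+ 2.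
  by rewrite exprn_even_gt0 //= !mulf_neq0 ?p0.
have ge0 : 0 <= (minor2 A X s y * minor2 A X t z) * (minor2 A X s z * minor2 A X y t).
  have : 0 <= (minor2 A X s y * minor2 A X t z) * (minor2 A X s z * minor2 A X y t) *
      ((K * K * (p s * p y * p t * p z)) ^+ 2 *
       ((y%:R - s%:R) * (z%:R - t%:R) * ((z%:R - s%:R) * (t%:R - y%:R)))).
    apply: le_trans (mulr_ge0 (mulr_ge0 h1 h2) (mulr_ge0 h3 h4)) _.
    by rewrite !wE le_eqVlt; apply/orP; left; apply/eqP; ring.
  by rewrite pmulr_lge0 // mulr_gt0.
have := pluecker3 t z sy0; set al := minor2 A X s y * _ in ge0 *.
set be := minor2 A X s z * _ in ge0 *.
have al0 : al != 0 by rewrite mulf_neq0.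
(* The two summands do not have opposite signs and the first is nonzero, so they cannot cancel. *)
have : al + be != 0.
  apply: contraTneq ge0 => /eqP; rewrite addr_eq0 => /eqP alE.
  rewrite -ltNge {1}alE mulNr oppr_lt0 -expr2 exprn_even_gt0 //=.
  by apply: contraNneq al0 => be0; rewrite alE be0 oppr0.
by move=> abN0 eq_ab; move: abN0; rewrite -eq_ab mulf_eq0 negb_or => /andP[].
Qed.

End Pluecker.

Lemma between_sign (F : realDomainType) (i j l : nat) : l != i -> l != j ->
  if (i < l < j)%N || (j < l < i)%N
  then (0 < (l%:R - i%:R) * (j%:R - l%:R) :> F)%R
  else ((l%:R - i%:R) * (j%:R - l%:R) < 0 :> F)%R.
Proof.
case: (ltngtP l i) => // lt_li _; case: (ltngtP l j) => // lt_lj _ /=.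
- by rewrite nmulr_rlt0 ?subr_lt0 ?subr_gt0 ?ltr_nat.
- by rewrite nmulr_rgt0 ?subr_lt0 ?subr_gt0 ?ltr_nat.
- by rewrite pmulr_rgt0 ?subr_lt0 ?subr_gt0 ?ltr_nat.
- by rewrite pmulr_rlt0 ?subr_lt0 ?subr_gt0 ?ltr_nat.
Qed.

(** * Crossing exchange in positroids *)

Section PositroidExchange.

Variables (R : realType) (T : finType) (P : ordered_matroid T).
Local Notation s := (ground_seq P).
Local Notation n := (size s).

Lemma ground_seqE (M : ordered_matroid T) : ground M = [set x in ground_seq M].
Proof. exact/esym/eqP/ground_seq_ground. Qed.

Local Open Scope ring_scope.

Lemma base_minor (A : 'M[R]_(mrank P, n)) (g : 'I_(mrank P) -> 'I_n) :
  represents A -> injective g ->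
  (labels (g @: setT) \in bases P) = (\det (colsub g A) != 0).
Proof.
move=> repA injg; set J := g @: setT.
have tnth_inj : injective (tnth (in_tuple s)).
  move=> i j eq_ij; apply: val_inj; apply/eqP.
  rewrite -(nth_uniq (tnth (in_tuple s) i) (ltn_ord i) (ltn_ord j) (ground_seq_uniq P)).
  by rewrite -!(tnth_nth _ (in_tuple s)) eq_ij.
have cJ : #|J| = mrank P by rewrite card_imset // cardsT card_ord.
have cL : #|labels J| = mrank P.
  by rewrite (card_imset _ tnth_inj).
transitivity (indep P (labels J)).
  apply/idP/idP=> [/base_indep//|indL].
  have /set0Pn[B BP] := bases_neq0 P.
  by apply: (indep_baseP BP indL); rewrite cL (mrankE BP).
rewrite repA -unitfE -unitmxE -row_free_unit /row_free.
congr (_ == _); last exact: cJ.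
rewrite -mxrank_tr -[RHS]mxrank_tr !trmx_mxsub.
have gJ i : g i \in J by apply: imset_f.
pose h i := enum_rank_in (gJ i) (g i).
have hK i : enum_val (h i) = g i by apply: enum_rankK_in.
(* [g] and [enum_val] list the same columns in possibly different orders; transposed, they span the
   same row space. *)
suff -> : (mxsub g id A^T :=: mxsub (@enum_val _ (mem J)) id A^T)%MS by [].
apply: (eqmx_rowsub h) => [i j eq_h||i]; last by rewrite /= hK.
  by apply: injg; rewrite -!hK eq_h.
by rewrite -cJ.
Qed.

Lemma positroid_crossing_exchange : positroid R P -> crossing_exchange s P.
Proof.
case=> A [_ repA A_ge0] X a b y z disX crab ayP bzP.
case/and3P: (crab); rewrite !inE !negb_or => /andP[ya yb] /andP[za zb] btw.
have ab : a != b by apply: contraTneq btw => ->; rewrite /between; clear; lia.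
have yz : y != z by apply: contraTneq btw => ->; rewrite addbb.
have inS B x : B \in bases P -> x \in B -> x \in s.
  by move=> /baseS/subsetP sB /sB; rewrite ground_seqE inE.
have aS : a \in s by apply: (inS _ _ ayP); rewrite !inE eqxx.
have yS : y \in s by apply: (inS _ _ ayP); rewrite !inE eqxx orbT.
have bS : b \in s by apply: (inS _ _ bzP); rewrite !inE eqxx.
have zS : z \in s by apply: (inS _ _ bzP); rewrite !inE eqxx orbT.
have XS x : x \in X -> x \in s.
  by move=> xX; apply: (inS _ _ ayP); rewrite !inE xX !orbT.
have notX x : x \in [set a; b; y; z] -> x \notin X.
  by move=> xin; rewrite (disjointFr disX xin).
(* The rank is written as a sum so that matrices over it fit [minor2]. *)
have rkE : mrank P = (#|X| + (1 + 1))%N.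
  rewrite (mrankE ayP) !cardsU1 !inE [a == y]eq_sym (negbTE ya).
  rewrite (negbTE (notX a _)) ?(negbTE (notX y _)) ?inE ?eqxx ?orbT //.
  by rewrite addnA addnC.
have a_lt : (index a s < n)%N by rewrite index_mem.
pose o x : 'I_n := insubd (Ordinal a_lt) (index x s).
have oE x : x \in s -> val (o x) = index x s.
  by move=> xs; rewrite val_insubd index_mem xs.
have oK x : x \in s -> tnth (in_tuple s) (o x) = x.
  by move=> xs; rewrite (tnth_nth x) /= oE // nth_index.
have o_inj x x' : x \in s -> x' \in s -> (o x == o x') = (x == x').
  move=> xs x's; apply/eqP/eqP=> [eq_o|-> //].
  by rewrite -(oK x xs) eq_o oK.
have := fun g => @base_minor A g repA.
move: A A_ge0 {repA}; rewrite rkE => A A_ge0 baseE.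
pose Xo (j : 'I_#|X|) := o (enum_val j).
have XoS j : enum_val j \in s := XS _ (enum_valP j).
have injX : injective Xo.
  move=> i j /eqP; rewrite o_inj ?XoS // => /eqP; exact: enum_val_inj.
have minorE u v : u \in s -> v \in s -> u != v -> u \notin X -> v \notin X ->
    (u |: (v |: X) \in bases P) = (minor2 A Xo (o u) (o v) != 0).
  move=> uS vS uv uX vX; rewrite -baseE; last first.
    apply: adjoin2_inj => // [|j|j]; rewrite o_inj ?XoS //.
      by apply: contraNneq uX => <-; apply: enum_valP.
    by apply: contraNneq vX => <-; apply: enum_valP.
  set L := labels _; suff -> : u |: (v |: X) = L by [].
  apply/setP=> x; rewrite {}/L; apply/idP/imsetP=> [|[_ /imsetP[i _ ->] ->]].
    rewrite !inE => /or3P[/eqP->|/eqP->|xX].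
    - exists (o u); last by rewrite oK.
      by apply/imsetP; exists (rshift _ 0); rewrite // adjoin2_rshift eqxx.
    - exists (o v); last by rewrite oK.
      by apply/imsetP; exists (rshift _ 1); rewrite // adjoin2_rshift.
    exists (o x); last by rewrite oK ?XS.
    apply/imsetP; exists (lshift _ (enum_rank_in xX x)) => //.
    by rewrite adjoin2_lshift /Xo enum_rankK_in.
  rewrite -[i]splitK; case: (split i) => j /=.
    by rewrite adjoin2_lshift oK ?XoS // !inE enum_valP !orbT.
  by rewrite adjoin2_rshift; case: ifP => _; rewrite oK // !inE eqxx ?orbT.
have [aX bX yX zX] : [/\ a \notin X, b \notin X, y \notin X & z \notin X].
  by split; apply: notX; rewrite !inE eqxx ?orbT.
have nX u j : u \in s -> u \notin X -> Xo j != o u.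
  move=> uS uX; rewrite o_inj ?XoS //.
  by apply: contraNneq uX => <-; apply: enum_valP.
have [|||||m1 m2] := @crossing_minors _ _ _ A Xo (o a) (o y) (o b) (o z) A_ge0 injX.
- by move=> j; rewrite !inE !negb_or !nX.
- rewrite /= !inE !negb_or !o_inj // [a == y]eq_sym ya ab [a == z]eq_sym za yb yz.
  by rewrite [b == z]eq_sym zb.
- rewrite -![nat_of_ord (o _)]/(val (o _)) !oE //.
  have neq_i u v : u \in s -> v \in s -> u != v -> index u s != index v s.
    move=> uS vS; apply: contra => /eqP eq_uv.
    by apply/eqP/(@pos_inj _ s); rewrite ?inE.
  have := @between_sign R (index a s) (index b s) (index y s).
  have := @between_sign R (index a s) (index b s) (index z s).
  move: btw; rewrite /between !neq_i //.
  (* The required product is minus the product of the two expressions in [between_sign], and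
     crossing gives these opposite signs. *)
  have prodE (p q u v : R) : (v - p) * (u - q) * ((u - p) * (q - v)) =
      - (((u - p) * (q - u)) * ((v - p) * (q - v))) by ring.
  case: ifP => _; case: ifP => _ //= _ /(_ isT isT) hz /(_ isT isT) hy.
    by rewrite prodE oppr_gt0 pmulr_rlt0.
  by rewrite prodE oppr_gt0 nmulr_rlt0.
- by rewrite -minorE // eq_sym.
- by rewrite -minorE // eq_sym.
by rewrite !minorE.
Qed.

End PositroidExchange.

(** * Necklaces *)

Section Necklace.

Variable T : finType.
Implicit Types (M N P : ordered_matroid T) (B J : {set T}) (s : seq T).

Lemma positions_inj s B B' : B \subset [set x in s] -> B' \subset [set x in s] ->
  positions s B = positions s B' -> B = B'.
Proof.
have sub (C D : {set T}) x : C \subset [set x in s] -> D \subset [set x in s] ->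
    positions s C = positions s D -> x \in C -> x \in D.
  move=> sC sD eqCD xC; have xs : x \in s by have := subsetP sC _ xC; rewrite inE.
  have : index x s \in positions s C.
    by apply: map_f; rewrite mem_filter xC.
  rewrite eqCD => /mapP[z]; rewrite mem_filter => /andP[zD zs].
  by move/(@pos_inj _ s)->; rewrite ?inE.
by move=> sB sB' eqB; apply/setP=> x; apply/idP/idP; apply: sub.
Qed.

(** A proper prefix precedes its extensions lexicographically, so [B] must have an element [x] after
    [y]; otherwise [positions s B] could be a prefix of [positions s B']. *)
Lemma positions_lt s B B' x y : uniq s -> x \in s -> x \in B -> y \in B' -> y \notin B ->
  index y s < index x s ->
  (forall z, z \in s -> index z s < index y s -> (z \in B') = (z \in B)) ->
  (positions s B' < positions s B)%O.
Proof.
move=> s_uniq xs xB yB' yB lt_yx eqB.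
have ys : y \in s by rewrite -index_mem (ltn_trans lt_yx) // index_mem.
have [s1 [s2 defs]] : exists s1 s2, s = s1 ++ y :: s2.
  by case/splitPr: ys => s1 s2; exists s1, s2.
have : uniq (s1 ++ y :: s2) by rewrite -defs.
rewrite cat_uniq /= negb_or => /and3P[_ /andP[ys1 /hasPn ns1] /andP[ys2 _]].
have idx_y : index y s = size s1 by rewrite defs index_cat (negbTE ys1) /= eqxx addn0.
have lt1 z : z \in s1 -> index z s < index y s.
  by move=> zs1; rewrite idx_y defs index_cat zs1 index_mem.
have lt2 z : z \in s2 -> index y s < index z s.
  move=> zs2; rewrite idx_y defs index_cat (negbTE (ns1 _ zs2)) /=.
  by have [yz|_] := eqVneq y z; [rewrite yz zs2 in ys2 | rewrite addnS ltnS leq_addr].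
have xs2 : x \in s2.
  have := xs; rewrite defs mem_cat inE => /or3P[/lt1|/eqP xy|//].
    by rewrite ltnNge (ltnW lt_yx).
  by rewrite xy ltnn in lt_yx.
have filterB' : [seq z <- s | z \in B'] = [seq z <- s1 | z \in B] ++ y :: [seq z <- s2 | z \in B'].
  rewrite {1}defs filter_cat /= yB'; congr (_ ++ _); apply: eq_in_filter => z zs1.
  by apply: eqB (lt1 _ zs1); rewrite defs mem_cat zs1.
have filterB : [seq z <- s | z \in B] = [seq z <- s1 | z \in B] ++ [seq z <- s2 | z \in B].
  by rewrite {1}defs filter_cat /= (negbTE yB).
have cat_lt (p q1 q2 : seqlexi nat) :
    (q1 < q2)%O -> ((p ++ q1 : seqlexi nat) < (p ++ q2 : seqlexi nat))%O.
  by move=> lt_q; elim: p => //= c p IHp; rewrite eqhead_ltxiE.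
have posE (C : {set T}) : positions s C = map (index^~ s) [seq z <- s | z \in C] by [].
rewrite !posE filterB filterB' !map_cat; apply: cat_lt => /=.
have : x \in [seq z <- s2 | z \in B] by rewrite mem_filter xB.
have : {subset [seq z <- s2 | z \in B] <= s2} by move=> z; rewrite mem_filter => /andP[].
case: [seq z <- s2 | z \in B] => [//|w l] sub_s2 _ /=.
have lt_w : index y s < index w s by apply/lt2/sub_s2; rewrite inE eqxx.
by rewrite ltxi_cons leEnat (ltnW lt_w) /= leqNgt lt_w.
Qed.

(** The greedy property: were some initial segment not met in a maximal independent set, an element
    [y] of it could replace a later element [x], giving a lexicographically smaller base. *)
Lemma lexmin_greedy M s B m : uniq s -> ground M = [set x in s] -> B \in bases M ->
  #|B :&: [set x in take m s]| <= #|lexmin_basis M s :&: [set x in take m s]|.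
Proof.
move=> s_uniq gM BM; have /andP[] := lexmin_basisP M s.
set J := lexmin_basis M s; set I := [set x in take m s].
move=> JM /forall_inP minJ; rewrite leqNgt; apply/negP=> lt_JI.
have [||N NM [sJN rkN]] := @indep_extend_rk _ M (J :&: I) I.
- exact: indepS (subsetIl _ _) (base_indep JM).
- exact: subsetIr.
have [y yNI yJI] : exists2 y, y \in N :&: I & y \notin J :&: I.
  apply/subsetPn; apply: contraL lt_JI => /subset_leq_card.
  by rewrite rkN -leqNgt; apply: leq_trans; apply: rk_base.
have [yN yI] := setIP yNI.
have yJ : y \notin J by apply: contra yJI => yJ; rewrite in_setI yJ.
have indy : indep M (y |: (J :&: I)).
  by apply: indepS (base_indep NM); rewrite subUset sub1set yN.
have [K KM [sK sKJ]] := indep_extend indy JM.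
have yK : y \in K by apply: (subsetP sK); apply: setU11.
have [x xJ xK] : exists2 x, x \in J & x \notin K.
  apply/subsetPn; apply: contraL (leqnn #|K|) => sJK; rewrite -ltnNge.
  have : #|y |: J| <= #|K| by apply: subset_leq_card; rewrite subUset sub1set yK.
  by rewrite cardsU1 yJ (card_base KM JM) add1n.
have defK : K = y |: J :\ x.
  apply/eqP; rewrite eqEcard card_swap // (card_base KM JM) leqnn andbT.
  apply/subsetP=> z zK; have := subsetP sKJ _ zK; rewrite !inE.
  have zx : z != x by apply: contraNneq xK => <-.
  by rewrite zx; case: (z == y) => //= /orP[/andP[]|].
have xI : x \notin I.
  by apply: contra xK => xI; apply: (subsetP sK); rewrite in_setU1 in_setI xJ xI orbT.
have xs : x \in s by have := subsetP (baseS JM) _ xJ; rewrite gM inE.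
have ys : y \in s by move: yI; rewrite inE => /mem_take.
have lt_yx : index y s < index x s.
  move: yI xI; rewrite !inE !in_take // -leqNgt; exact: leq_trans.
have := minJ _ KM; rewrite leNgt => /negP[]; apply: (positions_lt (x := x) (y := y)) => //.
move=> z zs lt_zy; rewrite defK !inE.
have [zy|_ /=] := eqVneq z y; first by rewrite zy ltnn in lt_zy.
by have [zx|//] := eqVneq z x; rewrite zx ltnNge (ltnW lt_yx) in lt_zy.
Qed.

Lemma necklaceP M N : ground_seq M = ground_seq N ->
  (necklace M = necklace N <-> forall k, k < size (ground_seq N) ->
     lexmin_basis M (rot k (ground_seq N)) = lexmin_basis N (rot k (ground_seq N))).
Proof.
move=> eqs; rewrite /necklace eqs; split=> [/eq_in_map eqk k lt_k | eqk].
  by apply: eqk; rewrite mem_iota.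
by apply/eq_in_map=> k; rewrite mem_iota; apply: eqk.
Qed.

(** By [lexmin_greedy] the rank of an arc is the size of its intersection with the necklace entry
    that starts where the arc starts. *)
Lemma envelope_arc_rk M P I : envelope_class P M -> cyclic_arc (ground_seq P) I ->
  rk M I = rk P I.
Proof.
case=> eqs /(necklaceP eqs) eqk [k [m ->]].
(* The necklace lists only rotations below the size; larger ones act as the identity. *)
wlog lt_k : k / k < size (ground_seq P) => [wlog_k|].
  have [lt_k|le_k] := ltnP k (size (ground_seq P)); first exact: wlog_k.
  rewrite rot_oversize // -(rot0 (ground_seq P)).
  have [s0|s_gt0] := posnP (size (ground_seq P)); last exact: wlog_k.
  suff -> : [set x in take m (rot 0 (ground_seq P))] = set0.
    apply/eqP; rewrite eqn_leq !(leq_trans (rk_le_card _ _)) ?cards0 //.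
  by rewrite (size0nil s0); apply/setP=> x; rewrite !inE.
have rkE (L : ordered_matroid T) : ground_seq L = ground_seq P ->
    rk L [set x in take m (rot k (ground_seq P))] =
    #|lexmin_basis L (rot k (ground_seq P)) :&: [set x in take m (rot k (ground_seq P))]|.
  move=> eqL; apply/eqP; rewrite eqn_leq rk_base ?andbT; last first.
    by case/andP: (lexmin_basisP L (rot k (ground_seq P))).
  have [B BL <-] := rk_attained L [set x in take m (rot k (ground_seq P))].
  apply: lexmin_greedy => //; first by rewrite rot_uniq ground_seq_uniq.
  by rewrite ground_seqE eqL; apply/setP=> x; rewrite !inE mem_rot.
by rewrite !rkE // eqk.
Qed.

Lemma envelope_thin_le (R : realType) M P :
  positroid R P -> envelope_class P M -> thin_le M P.
Proof.
move=> P_pos PM; have [eqs _] := PM.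
apply: (arc_rk_thin_le (ground_seq_uniq P)).
- by rewrite ground_seqE eqs.
- exact: ground_seqE.
- exact: positroid_crossing_exchange P_pos.
by move=> I; apply: envelope_arc_rk.
Qed.

(** Each necklace entry common to [M] and [P] is a base of [Z] and is already minimal among the
    bases of [P], so it is minimal in [Z]. *)
Lemma envelope_between M Z P : envelope_class P M -> ground_seq Z = ground_seq P ->
  bases M \subset bases Z -> bases Z \subset bases P -> envelope_class P Z.
Proof.
case=> eqs eqk eqZ sMZ sZP; split=> //; apply/(necklaceP eqZ) => k lt_k.
have {eqk} eqMP := (necklaceP eqs).1 eqk k lt_k; set s := rot k _ in eqMP *.
have /andP[JM _] := lexmin_basisP M s; rewrite eqMP in JM.
have /andP[LZ /forall_inP minL] := lexmin_basisP Z s.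
have /andP[JP /forall_inP minJ] := lexmin_basisP P s.
have sP B : B \in bases P -> B \subset [set x in s].
  move=> /baseS; rewrite ground_seqE => /subset_trans; apply.
  by apply/subsetP=> x; rewrite !inE mem_rot.
apply: (positions_inj (s := s)); [exact/sP/(subsetP sZP) | exact: sP |].
apply/eqP; rewrite eq_le minL ?(subsetP sMZ) //=.
exact/minJ/(subsetP sZP).
Qed.

Lemma ordered_matroid_inj M N : ground_seq M = ground_seq N -> bases M = bases N -> M = N.
Proof.
move=> eqs eqb; have eqg : ground M = ground N by rewrite !ground_seqE eqs.
case: M N eqs eqb eqg => [[gM bM hM1 hM2 hM3] sM uM eM] [[gN bN hN1 hN2 hN3] sN uN eN] /=.
move=> eqs eqb eqg; subst.
have [[e1 e2] e3] := (bool_irrelevance hM1 hN1, bool_irrelevance hM2 hN2, bool_irrelevance hM3 hN3).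
by subst; rewrite (bool_irrelevance uM uN) (bool_irrelevance eM eN).
Qed.

End Necklace.

Theorem theorem2p35 (R : realType) (T : finType) (P : ordered_matroid T)
    (Coll : ordered_matroid T -> Prop)
    (P_pos : positroid R P)
    (Coll_pos : forall Q : ordered_matroid T, Coll Q -> positroid R Q)
    (Coll_small : forall Q : ordered_matroid T,
        Coll Q -> mrank Q <= 2 \/ mcorank Q <= 2)
    (P_dec : decomposes_into Coll P) :
  is_join_semilattice (envelope_class P) (@weak_le T).
Proof.
split.
  split=> [M _|M N [eqM _] [eqN _] leMN leNM|M N L _ _ _]; rewrite /weak_le //.
    by apply: ordered_matroid_inj; [rewrite eqM eqN | apply/eqP; rewrite eqEsubset; apply/andP].
  exact: subset_trans.
move=> M N PM PN.
have thinM L : envelope_class P L -> thin_le L P by apply: envelope_thin_le P_pos.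
have [Z [gZ sZP sMZ sNZ leZ]] :=
  has_joins_decomposes Coll_small P_dec (thinM _ PM) (thinM _ PN).
have gsZ : [set x in ground_seq P] == ground Z by rewrite gZ -ground_seqE.
pose Zo := OrderedMatroid (ground_seq_uniq P) gsZ.
exists Zo; split=> //; first by apply: (envelope_between PM).
by move=> W PW MW NW; apply: leZ => //; apply: thinM.
Qed.
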